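(* Assume the generalized continuum hypothesis. The class of all completely regular semigroups is globally determined: if $S$ and $S'$ are completely regular semigroups such that the power semigroups $P(S)$ and $P(S')$ are isomorphic, then $S$ and $S'$ are isomorphic.
   Context: A semigroup $S$ is completely regular if for every $a\in S$ there exists $x\in S$ with $a=axa$ and $ax=xa$. The power semigroup (global) $P(S)$ of a semigroup $S$ is the semigroup of all nonempty subsets of $S$ with multiplication $AB=\{ab\mid a\in A,\ b\in B\}$. A class $\mathcal{K}$ of semigroups is globally determined if any two members of $\mathcal{K}$ having isomorphic power semigroups are themselves isomorphic. *)

(* Defs.v *)
From HB Require Import structures.
From mathcomp Require Import all_boot monoid.
From mathcomp Require Import boolp classical_sets functions cardinality.

Set Implicit Arguments.
Unset Strict Implicit.
Unset Printing Implicit Defensive.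

Local Open Scope classical_set_scope.
Local Open Scope card_scope.
Local Open Scope group_scope.

(* [set: T] and [set: set T] have cardinals k and 2^k. *)
Definition GCH : Prop :=
  forall T U : Type, infinite_set [set: T] ->
    [set: T] #<= [set: U] -> [set: U] #<= [set: set T] ->
    [set: U] #= [set: T] \/ [set: U] #= [set: set T].

Definition completely_regular (S : semigroupType) : Prop :=
  forall a : S, exists x : S, a = a * x * a /\ a * x = x * a.

Definition power (S : semigroupType) : Type := {A : set S | A !=set0}.

Section PowerSemigroup.
Variable S : semigroupType.
Implicit Types A B C : power S.

Lemma power_mul_subproof A B :
  [set a * b | a in sval A & b in sval B] !=set0.
Proof.
by case: A B => [A [a Aa]] [B [b Bb]]; exists (a * b), a => //; exists b.
Qed.

Definition power_mul A B : power S := exist _ _ (power_mul_subproof A B).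

Lemma power_mulA : associative power_mul.
Proof.
move=> A B C; apply: eq_exist => /=; apply/seteqP; split=> x /=.
  move=> [a Aa [_ [b Bb [c Cc <-]] <-]].
  by exists (a * b); [exists a => //; exists b|exists c => //; rewrite mulgA].
move=> [_ [a Aa [b Bb <-]] [c Cc <-]].
by exists a => //; exists (b * c); [exists b => //; exists c|rewrite mulgA].
Qed.

HB.instance Definition _ := gen_eqMixin (power S).
HB.instance Definition _ := gen_choiceMixin (power S).
HB.instance Definition _ := isSemigroup.Build (power S) power_mulA.

End PowerSemigroup.

Definition isomorphic (S S' : semigroupType) : Prop :=
  exists f : {multiplicative S -> S'}, bijective f.

Definition globally_determined (K : semigroupType -> Prop) : Prop :=
  forall S S' : semigroupType, K S -> K S' ->
    isomorphic (power S) (power S') -> isomorphic S S'.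

(* Main.v *)
(* Write psi for an isomorphism of P(S) onto P(S').

   If e is idempotent then no proper subset of E = psi({e}) has square E, because
   Y Y = {e} forces Y {e} = Y.  This makes E a band in which every product is one
   of its factors; comparing the idempotents of P(S) and P(S') that cover {e} and
   E then shows that E is a left zero or a right zero band.

   If E is a left zero band with at least two elements, then no idempotent lies
   strictly above e.  More generally e is R-maximal (not fixed on the left by an
   element of a higher component), and the elements of E are twins: they multiply
   alike on the right of every element, and on the left of every element not lying
   above them.  Replacing each idempotent by its class of twins, psi matches the
   subsets of a class [e] with the subsets of a class [f] for f in E, so that, by
   the generalized continuum hypothesis, [e] and [f] have the same cardinality.
   Bijections between twin classes, chosen for R-classes and dually for L-classes,
   correct the multivalued map a |-> psi({a}) into an isomorphism
   a |-> beta(a) psi({a}) gamma(a). *)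

Require Import Defs.
From HB Require Import structures.
From mathcomp Require Import all_boot monoid.
From mathcomp Require Import boolp classical_sets functions cardinality.

Set Implicit Arguments.
Unset Strict Implicit.
Unset Printing Implicit Defensive.

Local Open Scope classical_set_scope.

(** The obstacle is that [psi] may send singletons to larger sets, and that on a twin class it only
    compares subsets, never points. Two injections, one in each direction, make the powersets of two
    twin classes equipotent by Schroeder-Bernstein, and the continuum hypothesis is spent solely on
    passing from [2^k = 2^l] to [k = l]. The bijection obtained this way is unrelated to [psi]. It
    can still serve as a correction because a twin may replace another on the right of every factor:
    in [beta(a) psi({a}) gamma(a) * beta(b) psi({b}) gamma(b)] the two inner corrections vanish,
    being seen only from the side on which twins agree, while the outer ones decide the R-class and
    the L-class of the product. The half of the argument that concerns [gamma] is the half for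
    [beta] read in the opposite semigroups. *)

Section Cardinals.

(** * Cardinals under the generalized continuum hypothesis *)

Local Open Scope card_scope.

Lemma inj_card_leT T U (f : T -> U) : injective f -> [set: T] #<= [set: U].
Proof.
move=> f_inj; have : f @` [set: T] #= [set: T].
  by apply: inj_card_eq => x y _ _; exact: f_inj.
rewrite card_eq_sym card_eq_le => /andP[h _].
by apply: card_le_trans h _; exact: subset_card_le.
Qed.

Lemma bij_card_eqT T U (f : T -> U) : bijective f -> [set: T] #= [set: U].
Proof.
move=> [g fK gK]; rewrite card_eq_le (inj_card_leT (can_inj fK)).
exact: inj_card_leT (can_inj gK).
Qed.

Lemma card_eqT_bij T U : [set: T] #= [set: U] -> exists f : T -> U, bijective f.
Proof.
move=> /card_bijP[f [g fK gK]].
have valK V (x : [set: V]) : to_setT (val x) = x by exact: val_inj.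
exists (fun x => val (f (to_setT x))), (fun y => val (g (to_setT y))) => x.
  by rewrite valK fK.
by rewrite valK gK.
Qed.

(** Zorn's lemma gives a maximal graph [G] of a partial injection; it is total on one side, since
    otherwise a fresh pair could be added. *)
Lemma card_leT_total T U : [set: T] #<= [set: U] \/ [set: U] #<= [set: T].
Proof.
pose P (G : set (T * U)) := forall x y, G x -> G y -> x.1 = y.1 <-> x.2 = y.2.
have [|G [PG maxG]] := @Zorn_bigcup (T * U)%type P.
  move=> F FP totF x y [X FX Xx] [Y FY Yy].
  by have [XY|YX] := totF _ _ FX FY;
    [apply: (FP _ FY) => //; exact: XY|apply: (FP _ FX) => //; exact: YX].
have [dom|/existsNP[t nt]] := pselect (forall t, exists u, G (t, u)).
  have [f Gf] := choice dom; left; apply: (@inj_card_leT _ _ f) => x y fxy.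
  exact: (PG _ _ (Gf x) (Gf y)).2.
have [cod|/existsNP[u nu]] := pselect (forall u, exists t, G (t, u)).
  have [f Gf] := choice cod; right; apply: (@inj_card_leT _ _ f) => x y fxy.
  exact: (PG _ _ (Gf x) (Gf y)).1.
case: (maxG (G `|` [set (t, u)])).
  split; first by move=> ?; left.
  by move=> h; apply: nt; exists u; apply: h; right.
move=> x y [Gx|->] [Gy|->] //=; first exact: PG.
- split=> h; first by case: nt; exists x.2; rewrite -h -surjective_pairing.
  by case: nu; exists x.1; rewrite -h -surjective_pairing.
- split=> h; first by case: nt; exists y.2; rewrite h -surjective_pairing.
  by case: nu; exists y.1; rewrite h -surjective_pairing.
Qed.

Lemma card_powerset_II T n : [set: T] #= `I_n -> [set: set T] #= `I_(2 ^ n).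
Proof.
move=> Tn; have [f [g fK gK]] := card_eqT_bij (card_eq_trans Tn card_II).
have -> : (2 ^ n)%N = #|{set 'I_n}|.
  by rewrite -{1}(card_ord n) -cardsT -card_powerset powersetT cardsT.
rewrite (card_eqr card_II).
pose h (A : set T) := finset.finset (fun i : 'I_n => `[< A (g i) >]).
pose k (X : {set 'I_n}) : set T := fun t => f t \in X.
apply: (@bij_card_eqT _ _ (fun A => enum_rank (h A))).
exists (fun i => k (enum_val i)) => [A|i].
  by rewrite /= enum_rankK; apply/seteqP; split=> t;
    rewrite /k /h /= finset.inE fK; [move/asboolP|move=> ?; apply/asboolP].
rewrite /h /k -[RHS]enum_valK; congr enum_rank.
by apply/setP => x; rewrite finset.inE gK; apply/asboolP/idP.
Qed.

Lemma card_le_powerset T : [set: T] #<= [set: set T].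
Proof.
apply: (@inj_card_leT _ _ (fun x : T => [set x])) => x y h.
by have : [set y] x by rewrite -h.
Qed.

Lemma card_powerset_neq T : ~ ([set: T] #= [set: set T]).
Proof.
move=> /card_eqT_bij[f [g _ gK]]; pose D := [set x | ~ f x x].
have h : D (g D) <-> ~ D (g D) by rewrite {1}/D /= gK.
have nD : ~ D (g D) by move=> d; exact: (h.1 d d).
exact: nD (h.2 nD).
Qed.

(** For infinite [T] with [T <= U], the cardinal of [U] lies between those of [T] and [set T]. Were
    it that of [set T], hence of [set U], Cantor's theorem would be violated. Finite cardinals are
    handled by injectivity of [2 ^ n]. *)
Lemma GCH_powerset_inj : GCH ->
  forall T U : Type, [set: set T] #= [set: set U] -> [set: T] #= [set: U].
Proof.
move=> gch; have key (T U : Type) : [set: T] #<= [set: U] ->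
    [set: set T] #= [set: set U] -> [set: T] #= [set: U].
  move=> TU PTU; have [[n Tn]|infT] := pselect (finite_set [set: T]).
    have PT := card_powerset_II Tn.
    have [m Um] : finite_set [set: U].
      apply: (@card_le_finite _ _ _ `I_(2 ^ n)); last exact: finite_II.
      by rewrite -(card_le_eqr PT) (card_le_eqr PTU) card_le_powerset.
    have : `I_(2 ^ n) #= `I_(2 ^ m).
      by rewrite -(card_eql PT) (card_eql PTU) card_powerset_II.
    move=> /card_eq_II/(expnI (isT : 1 < 2)) nm.
    by rewrite (card_eql Tn) nm card_eq_sym.
  have [|h|h] := gch T U infT TU.
  - by rewrite (card_le_eqr PTU) card_le_powerset.
  - by rewrite card_eq_sym.
  - by case: (@card_powerset_neq U); rewrite (card_eql h).
move=> T U TU; have [h|h] := card_leT_total T U; first exact: key.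
by rewrite card_eq_sym; apply: key => //; rewrite card_eq_sym.
Qed.

Lemma GCH_subsets_bij (S T : Type) (A : set S) (B : set T)
    (i : set S -> set T) (j : set T -> set S) : GCH ->
    (forall X, X `<=` A -> i X `<=` B) ->
    (forall X Y, X `<=` A -> Y `<=` A -> i X = i Y -> X = Y) ->
    (forall X, X `<=` B -> j X `<=` A) ->
    (forall X Y, X `<=` B -> Y `<=` B -> j X = j Y -> X = Y) ->
  exists h : {x | A x} -> {y | B y}, bijective h.
Proof.
move=> gch iAB i_inj jBA j_inj; apply/card_eqT_bij/(GCH_powerset_inj gch).
have key (S' T' : Type) (A' : set S') (B' : set T') (k : set S' -> set T') :
    (forall X, X `<=` A' -> k X `<=` B') ->
    (forall X Y, X `<=` A' -> Y `<=` A' -> k X = k Y -> X = Y) ->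
    [set: set {x | A' x}] #<= [set: set {y | B' y}].
  move=> kAB k_inj; have sA X : (@sval S' A') @` X `<=` A' by move=> _ [[x Ax] _ <-].
  apply: (@inj_card_leT _ _ (fun X => [set y | k (sval @` X) (sval y)])) => X Y XY.
  have : sval @` X = sval @` Y.
    apply: k_inj => //; apply/seteqP; split=> y ky.
      have By := kAB _ (@sA X) _ ky.
      have : [set y | k (sval @` X) (sval y)] (exist _ y By) by [].
      by rewrite XY.
    have By := kAB _ (@sA Y) _ ky.
    have : [set y | k (sval @` Y) (sval y)] (exist _ y By) by [].
    by rewrite -XY.
  move=> E; apply/seteqP; split=> x h.
    have : (sval @` Y) (sval x) by rewrite -E; exists x.
    by move=> [y Yy /eq_sig_hprop <-] // ? ? ?; exact: Prop_irrelevance.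
  have : (sval @` X) (sval x) by rewrite E; exists x.
  by move=> [y Yy /eq_sig_hprop <-] // ? ? ?; exact: Prop_irrelevance.
by rewrite card_eq_le (key _ _ _ _ i) // (key _ _ _ _ j).
Qed.

End Cardinals.

(* Completely regular semigroups and products of subsets *)
Declare Scope cr_scope.
Delimit Scope cr_scope with cr.
Local Open Scope cr_scope.

(* Semigroups in which every element has a distinguished commuting inverse.
   Kept outside the packed hierarchy so that the opposite of such a semigroup is
   available by conversion for dual statements. *)
Record crsemigroup := CRSemigroup {
  car :> Type;
  mul : car -> car -> car;
  inv : car -> car;
  mulA : forall x y z, mul x (mul y z) = mul (mul x y) z;
  mulVK : forall x, mul (mul x (inv x)) x = x;
  mulC_inv : forall x, mul x (inv x) = mul (inv x) x;
  invVK : forall x, mul (mul (inv x) x) (inv x) = inv x }.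

Local Notation "x * y" := (mul x y) : cr_scope.

Definition setmul (S : crsemigroup) (A B : set S) : set S :=
  [set c | exists a b, [/\ A a, B b & c = a * b]].

Local Notation "A ** B" := (setmul A B) (at level 40, left associativity) : cr_scope.

Section Opposite.
Variable S : crsemigroup.

Definition op_mul (x y : S) := y * x.

Lemma op_mulA x y z : op_mul x (op_mul y z) = op_mul (op_mul x y) z.
Proof. by rewrite /op_mul mulA. Qed.

Lemma op_mulVK x : op_mul (op_mul x (inv x)) x = x.
Proof. by rewrite /op_mul mulA mulVK. Qed.

Lemma op_mulC_inv x : op_mul x (inv x) = op_mul (inv x) x.
Proof. by rewrite /op_mul mulC_inv. Qed.

Lemma op_invVK x : op_mul (op_mul (inv x) x) (inv x) = inv x.
Proof. by rewrite /op_mul mulA invVK. Qed.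

Definition op : crsemigroup := CRSemigroup op_mulA op_mulVK op_mulC_inv op_invVK.

Lemma setmul_op (A B : set S) : @setmul op A B = B ** A.
Proof. by apply/seteqP; split=> x [a [b [? ? ->]]]; exists b, a. Qed.

End Opposite.

Section SetProduct.
Variable S : crsemigroup.
Implicit Types A B C D : set S.

Lemma setmul_in A B a b : A a -> B b -> (A ** B) (a * b).
Proof. by move=> ? ?; exists a, b. Qed.

Lemma setmulA A B C : A ** (B ** C) = (A ** B) ** C.
Proof.
apply/seteqP; split=> x.
  move=> [a [_ [Aa [b [c [Bb Cc ->]]] ->]]].
  by rewrite mulA; do 2?apply: setmul_in.
move=> [_ [c [[a [b [Aa Bb ->]]] Cc ->]]].
by rewrite -mulA; do 2?apply: setmul_in.
Qed.

Lemma setmul1 (a b : S) : [set a] ** [set b] = [set a * b].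
Proof. by apply/seteqP; split=> [x [_ [_ [-> -> ->]]]|x ->] //; apply: setmul_in. Qed.

Lemma setmulUl A B C : (A `|` B) ** C = (A ** C) `|` (B ** C).
Proof.
apply/seteqP; split=> x.
  by move=> [a [c [[?|?] ? ->]]]; [left|right]; apply: setmul_in.
by move=> [|] [a [c [? ? ->]]]; apply: setmul_in => //; [left|right].
Qed.

Lemma setmulUr A B C : C ** (A `|` B) = (C ** A) `|` (C ** B).
Proof.
apply/seteqP; split=> x.
  by move=> [c [a [? [?|?] ->]]]; [left|right]; apply: setmul_in.
by move=> [|] [c [a [? ? ->]]]; apply: setmul_in => //; [left|right].
Qed.

Lemma setmulS A B C D : A `<=` B -> C `<=` D -> A ** C `<=` B ** D.
Proof. by move=> AB CD x [a [c [/AB ? /CD ? ->]]]; apply: setmul_in. Qed.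

Lemma setmul1l a B x : ([set a] ** B) x <-> exists2 b, B b & x = a * b.
Proof.
split=> [[_ [b [-> ? ->]]]|[b ? ->]]; [by exists b|exact: setmul_in].
Qed.

Lemma setmul1r a B x : (B ** [set a]) x <-> exists2 b, B b & x = b * a.
Proof.
split=> [[b [_ [? -> ->]]]|[b ? ->]]; [by exists b|exact: setmul_in].
Qed.

Lemma setmuln0 A B : A !=set0 -> B !=set0 -> A ** B !=set0.
Proof. by move=> [a ?] [b ?]; exists (a * b); apply: setmul_in. Qed.

End SetProduct.


(** * Local identities and the order of components *)

Section CompletelyRegular.
Variable S : crsemigroup.
Implicit Types a b c e f k l s t x y z : S.

(* The identity of the maximal subgroup containing [a]. *)
Definition loc a := a * inv a.

Lemma locl a : loc a * a = a. Proof. exact: mulVK. Qed.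

Lemma locr a : a * loc a = a.
Proof. by rewrite /loc mulC_inv mulA mulVK. Qed.

Lemma loc_inv a : loc a * inv a = inv a.
Proof. by rewrite /loc mulC_inv invVK. Qed.

Lemma inv_loc a : inv a * loc a = inv a.
Proof. by rewrite /loc mulA invVK. Qed.

Definition idem e := e * e = e.

Lemma loc_idem a : idem (loc a).
Proof. by rewrite /idem {2}/loc mulA locl. Qed.

Lemma loc_id e : idem e -> loc e = e.
Proof. by move=> ee; rewrite -{2}(locr e) /loc mulA ee. Qed.

Lemma idem_sqr a : idem (a * a) -> a * a = loc a.
Proof.
move=> aa; have h : a * a * a = a.
  have : a * (a * a * a) = a * a by rewrite !mulA -[RHS]aa !mulA.
  by move/(congr1 (mul (inv a))); rewrite !mulA -mulC_inv -/(loc a) locl.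
by rewrite /loc -{3}h -mulA -/(loc a) -mulA locr.
Qed.

(* The preorder of principal two-sided ideals; no identity has to be adjoined
   since [a = loc a * a * loc a]. *)
Definition jle a b := exists u v, a = u * b * v.

Lemma jle_refl a : jle a a.
Proof. by exists (loc a), (loc a); rewrite locl locr. Qed.

Lemma jle_trans b a c : jle a b -> jle b c -> jle a c.
Proof.
by move=> [u [v ->]] [w [z ->]]; exists (u * w), (z * v); rewrite !mulA.
Qed.

Lemma jle_mull a b : jle (a * b) a.
Proof. by exists (loc a), b; rewrite locl. Qed.

Lemma jle_mulr a b : jle (a * b) b.
Proof. by exists a, (loc b); rewrite -mulA locr. Qed.

Lemma jle_sqr a : jle a (a * a).
Proof. by exists (loc a), (inv a); rewrite mulA locl -mulA -/(loc a) locr. Qed.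

Lemma jle_loc a : jle a (loc a).
Proof. by rewrite -{1}(locl a); apply: jle_mull. Qed.

Lemma loc_jle a : jle (loc a) a.
Proof. exact: jle_mull. Qed.

(* The components of a completely regular semigroup form a semilattice. *)
Lemma jle_mul a b c : jle a b -> jle a c -> jle a (b * c).
Proof.
move=> [u [v ab]] [w [z ac]]; apply: (jle_trans (jle_sqr a)).
(* With [y = c * (z * u) * b] one has [a * a = w * y * v]; so [a] is below [y], hence below [y * y],
   in which [b * c] occurs as a factor. *)
have h : jle (a * a) (c * (z * u) * b).
  by exists w, v; rewrite {1}ac ab !mulA.
apply: (jle_trans h); apply: (jle_trans (jle_sqr _)).
by exists (c * (z * u)), (z * u * b); rewrite !mulA.
Qed.

(** Stability: [a] lies below [a * b], which gives [a = u * a * w] with [w = b * v]. Then [loc w]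
    fixes [a] on the right, and dividing by [w] writes [a] as a right multiple of [a * b]. *)
Lemma jle_loc_mul a b : jle a b -> loc (a * b) * a = a.
Proof.
move=> /(jle_mul (jle_refl a)) [u [v h]].
have ua : loc u * a = a by rewrite h !mulA locl.
pose w := b * v; have h' : a = u * a * w by rewrite /w !mulA -(mulA u).
have aw : a * loc w = a by rewrite h' -mulA locr.
have e : a = a * b * (v * inv w) by rewrite -{1}aw /loc {1}/w !mulA.
by rewrite {2}e mulA locl -e.
Qed.

Lemma loc_mull a b : loc a * (a * b) = a * b.
Proof. by rewrite mulA locl. Qed.

End CompletelyRegular.

Lemma loc_op (S : crsemigroup) (a : S) : @loc (op S) a = loc a.
Proof. by rewrite /loc mulC_inv. Qed.

Lemma jle_op (S : crsemigroup) (a b : S) : @jle (op S) a b = jle a b.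
Proof.
by apply/propext; split=> [] [u [v ->]]; exists v, u; rewrite /= /op_mul /= mulA.
Qed.

Lemma jle_loc_mulr (S : crsemigroup) (a b : S) : jle a b -> a * loc (b * a) = a.
Proof. by rewrite -jle_op => /jle_loc_mul; rewrite loc_op. Qed.

(** * Factorizations in a set that is the square of no proper subset *)

Section SquareIrreducible.
Variable S : crsemigroup.
Implicit Types (E X : set S) (a b m t w y z : S).

Definition sqirr E :=
  E ** E = E /\ forall X, X `<=` E -> X ** X = E -> X = E.

Definition prime_in E m := forall a b, E a -> E b -> a * b = m -> a = m \/ b = m.

(** [z] generates a group of order two with identity [z * z], and it factors in [E] only inside that
    group. *)
Definition inv2_in E z :=
  [/\ E z, z <> z * z, idem (z * z) & forall a b, E a -> E b -> a * b = z ->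
    a = z /\ b = z * z \/ a = z * z /\ b = z].

Variable E : set S.
Hypothesis irrE : sqirr E.

Let EE a b : E a -> E b -> E (a * b).
Proof. by move=> Ea Eb; rewrite -irrE.1; apply: setmul_in. Qed.

(** The square of [E] without [m] must miss some [z] of [E]; every factorization of that [z] uses
    [m]. *)
Let witness m : E m ->
  exists z, E z /\ forall a b, E a -> E b -> a * b = z -> a = m \/ b = m.
Proof.
move=> Em; apply: contrapT => /forallNP h.
have hE : E `\ m = E.
  apply: irrE.2 => [x []//|]; apply/seteqP; split=> [_ [a [b [[Ea _] [Eb _] ->]]]|z Ez].
    exact: EE.
  apply: contrapT => nz; apply: (h z); split=> // a b Ea Eb abz.
  apply: contrapT => /not_orP[am bm]; apply: nz; rewrite -abz.
  by apply: setmul_in; split.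
by have : E m := Em; rewrite -hE => -[_]; apply.
Qed.

(* Cutting a fourfold factorization of the witness in three places yields the
   factor [m] twice on the same side, whence a local unit [t] of [m]. *)
Let local_unit m : E m -> exists t, E t /\ (m * t = m \/ t * m = m).
Proof.
move=> Em; have [z [Ez hz]] := witness Em.
have split2 x : E x -> exists a b, [/\ E a, E b & x = a * b].
  by rewrite -{1}irrE.1 => -[a [b [? ? ?]]]; exists a, b.
have [x [y [Ex Ey zxy]]] := split2 z Ez.
have [a [b [Ea Eb xab]]] := split2 x Ex.
have [c [d [Ec Ed ycd]]] := split2 y Ey.
have h1 := hz a (b * y) Ea (EE Eb Ey).
have h2 := hz x y Ex Ey.
have h3 := hz (x * c) d (EE Ex Ec) Ed.
case: h2 => // [xm|ym].
- case: h1 => [|am|bym].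
  + by rewrite zxy xab !mulA.
  + by exists b; split=> //; left; rewrite -{1}am -xab.
  + case: h3 => [|xcm|dm].
    * by rewrite zxy ycd !mulA.
    * by exists c; split=> //; left; rewrite -{1}xm.
    * exists (b * c); split; first exact: EE.
      by right; rewrite -{1}dm -mulA -ycd.
- case: h1 => [|am|bym].
  + by rewrite zxy xab !mulA.
  + case: h3 => [|xcm|dm].
    * by rewrite zxy ycd !mulA.
    * exists (b * c); split; first exact: EE.
      by left; rewrite -{1}am !mulA -xab.
    * by exists c; split=> //; right; rewrite -{1}dm -ycd.
  + by exists b; split=> //; right; rewrite -{1}ym.
Qed.

(** A local unit of [z] is a factor of [z] other than [z], so it is [m]; absorbing it twice, [z]
    also factors through [m * m], which must then be [m]. *)
Let idem_wit m z : E m -> E z -> z <> m ->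
    (forall a b, E a -> E b -> a * b = z -> a = m \/ b = m) ->
  idem m /\ (z * m = z \/ m * z = z).
Proof.
move=> Em Ez zm hz; have [t [Et [zt|tz]]] := local_unit Ez.
- have [//|tm] := hz _ _ Ez Et zt; rewrite tm in zt; split; last by left.
  by case: (hz z (m * m)) => //; [exact: EE|rewrite mulA !zt].
- have [tm|//] := hz _ _ Et Ez tz; rewrite tm in tz; split; last by right.
  by case: (hz (m * m) z) => //; [exact: EE|rewrite -mulA !tz].
Qed.

(** Let [z] be a witness of [m]. If [z = m], then [m] is prime. Otherwise [z] is not idempotent, so
    it is its own witness, while [z * z] cannot be its own and is therefore idempotent; now
    [z = z * (z * z)] shows that [z * z] is [m]. *)
Lemma sqirr_cases m : E m ->
  prime_in E m \/ exists z, [/\ inv2_in E z & m = z * z].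
Proof.
move=> Em; have [z [Ez hz]] := witness Em.
have [zm|zm] := pselect (z = m).
  by left=> a b Ea Eb abm; apply: hz => //; rewrite zm.
right; exists z.
have [mm zmz] := idem_wit Em Ez zm hz.
have zz : z * z <> z by move=> /(hz _ _ Ez Ez) [].
have hz' a b : E a -> E b -> a * b = z -> a = z \/ b = z.
  have [w [Ew hw]] := witness Ez.
  have [wz|wz] := pselect (w = z); first by rewrite -{1}wz; apply: hw.
  by have [/zz] := idem_wit Ez Ew wz hw.
have Ezz := EE Ez Ez.
have zz_idem : idem (z * z).
  have [w [Ew hw]] := witness Ezz.
  have [wzz|wzz] := pselect (w = z * z); last by have [] := idem_wit Ezz Ew wzz hw.
  by case: (hw z z Ez Ez (esym wzz)) => /esym/zz.
have zzm : z * z = m.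
  have zzz : z * (z * z) = z by rewrite idem_sqr// locr.
  by case: (hz z (z * z) Ez Ezz zzz).
split; [split=> //; [by move=> /esym/zz|]|by []].
move=> a b Ea Eb abz; rewrite zzm.
case: (hz a b Ea Eb abz) => [am|bm]; case: (hz' a b Ea Eb abz) => [az|bz].
- by case: zm; rewrite -az am.
- by right.
- by left.
- by case: zm; rewrite -bz bm.
Qed.

Lemma sqirr_sqr y : E y -> idem (y * y).
Proof.
move=> Ey; case: (sqirr_cases (EE Ey Ey)) => [p|[z [[_ _ zz _] ->]]].
  have yy : y * y = y by case: (p y y).
  by rewrite yy.
by rewrite /idem zz.
Qed.

Lemma sqirr_cube y : E y -> y * (y * y) = y.
Proof. by move=> Ey; rewrite (idem_sqr (sqirr_sqr Ey)) locr. Qed.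

Lemma sqirr_mul a b : E a -> E b -> E (a * b).
Proof. exact: EE. Qed.

End SquareIrreducible.

(* Acts on all subsets: an isomorphism of power semigroups extends to the empty
   set, which is a zero, and this removes all nonemptiness side conditions. *)
Record power_iso (S T : crsemigroup) := PowerIso {
  fwd : set S -> set T;
  bwd : set T -> set S;
  fwdK : forall A, bwd (fwd A) = A;
  bwdK : forall B, fwd (bwd B) = B;
  fwdM : forall A B, fwd (A ** B) = fwd A ** fwd B }.

Lemma bwdM S T (p : power_iso S T) A B : bwd p (A ** B) = bwd p A ** bwd p B.
Proof. by rewrite -{1}(bwdK p A) -{1}(bwdK p B) -fwdM fwdK. Qed.

Definition power_iso_sym S T (p : power_iso S T) : power_iso T S :=
  PowerIso (bwdK p) (fwdK p) (bwdM p).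

Lemma op_fwdM S T (p : power_iso S T) (A B : set (op S)) :
  fwd p (A ** B) = @setmul (op T) (fwd p A) (fwd p B).
Proof. by rewrite !setmul_op fwdM. Qed.

Definition power_iso_op S T (p : power_iso S T) : power_iso (op S) (op T) :=
  @PowerIso (op S) (op T) (fwd p) (bwd p) (fwdK p) (bwdK p) (op_fwdM p).

Section PowerIso.
Variables (S T : crsemigroup) (p : power_iso S T).

Lemma fwd_inj A B : fwd p A = fwd p B -> A = B.
Proof. by move/(congr1 (bwd p)); rewrite !fwdK. Qed.

Lemma fwd0 : fwd p set0 = set0.
Proof.
have h A : fwd p set0 ** A = fwd p set0.
  rewrite -(bwdK p A) -fwdM; congr fwd.
  by apply/seteqP; split=> x // [? [? []]].
by rewrite -(h set0); apply/seteqP; split=> x // [? [? []]].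
Qed.

Lemma fwd_n0 A : A !=set0 -> fwd p A !=set0.
Proof.
move=> A0; apply/set0P/eqP => h; case: A0 => a.
by rewrite (_ : A = set0) //; apply: fwd_inj; rewrite h fwd0.
Qed.

End PowerIso.

Definition left_zero (S : crsemigroup) (A : set S) := forall a b, A a -> A b -> a * b = a.
Definition right_zero (S : crsemigroup) (A : set S) := forall a b, A a -> A b -> a * b = b.

(** * The image of an idempotent is a left zero or a right zero band *)

Section Quasitrivial.
Variables (S T : crsemigroup) (p : power_iso S T) (e : S).
Hypothesis ee : idem e.

Let E := fwd p [set e].

Let EE : E ** E = E.
Proof. by rewrite /E -fwdM setmul1 ee. Qed.

Let irrE : sqirr E.
Proof.
split=> // X XE XX; pose Y := bwd p X.
have YY : Y ** Y = [set e] by rewrite /Y -bwdM XX /E fwdK.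
have ye y : Y y -> y * e = y.
  move=> Yy; have ye : y * y = e by have : (Y ** Y) (y * y) by [exact: setmul_in]; rewrite YY.
  by rewrite -ye idem_sqr ?locr // /idem ye.
have Ye : Y ** [set e] = Y.
  apply/seteqP; split=> [x /setmul1r[y Yy ->]|y Yy]; first by rewrite ye.
  by apply/setmul1r; exists y; rewrite ?ye.
have XeX : X ** E = X by rewrite -(bwdK p X) -/Y /E -fwdM Ye.
apply/seteqP; split=> // x; rewrite -XX => h; rewrite -XeX.
by apply: setmulS h.
Qed.

Let Emul a b : E a -> E b -> E (a * b).
Proof. exact: sqirr_mul. Qed.

(* [Z] covers [E] in the natural order of the idempotents of the power semigroup. *)
Let cover (Z : set T) := forall W, W ** W = W -> W ** Z = W -> Z ** W = W ->
  W ** E = E -> E ** W = E -> W = Z \/ W = E.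

Let cover_bwd Z F : cover Z -> F ** F = F -> F ** bwd p Z = F ->
  bwd p Z ** F = F -> F ** [set e] = [set e] -> [set e] ** F = [set e] ->
  F = bwd p Z \/ F = [set e].
Proof.
move=> cZ FF FZ ZF Fe eF.
have : fwd p F = Z \/ fwd p F = E.
  apply: cZ; first by rewrite -fwdM FF.
  - by rewrite -{2}FZ fwdM bwdK.
  - by rewrite -{2}ZF fwdM bwdK.
  - by rewrite -fwdM Fe.
  - by rewrite -fwdM eF.
by move=> [<-|/fwd_inj->]; [left; rewrite fwdK|right].
Qed.

(** [N] and [N'] form a group of order two in the power semigroup, and its identity [N] covers [E].
    The union of their preimages is an idempotent between [{e}] and the preimage of [N], so it is
    one of the two; either way [N = N']. *)
Let no_inv2 z : inv2_in E z -> False.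
Proof.
move=> [Ez zzz zz hz]; pose m := z * z.
have Em : E m by exact: Emul.
have zm : z * m = z by rewrite /m idem_sqr ?locr.
have mz : m * z = z by rewrite /m idem_sqr ?locl.
pose N := E `\ z; pose N' := E `\ m.
have Nm : N m by split=> //; apply/nesym.
have Nz : N' z by split.
have sqN y : E y -> N (y * y).
  move=> Ey; split; first exact: Emul.
  by move=> /= yz; apply: zzz; rewrite -yz; apply/esym/(sqirr_sqr irrE).
have sqN' y : E y -> y <> z -> y <> m -> N' (y * y).
  move=> Ey yz ym; split; first exact: Emul.
  move=> /= yym; have : z * y * y = z by rewrite -mulA yym.
  by move/(hz _ _ (Emul Ez Ey) Ey) => [[_ ?]|[_ ?]]; [apply: ym|apply: yz].
have cube := sqirr_cube irrE.
have cube' y : E y -> y * y * y = y by move=> Ey; rewrite -mulA cube.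
have NE a : N a -> E a by case.
have N'E a : N' a -> E a by case.
have NN : N ** N = N.
  apply/seteqP; split=> [_ [a [b [[Ea /= az] [Eb /= bz] ->]]]|y [Ey yz]].
    split; first exact: Emul.
    by move=> /(hz _ _ Ea Eb) [[]|[]].
  by rewrite -(cube y Ey); apply: setmul_in => //; exact: sqN.
have N'N' : N' ** N' = N.
  apply/seteqP; split=> [_ [a [b [[Ea /= am] [Eb /= bm] ->]]]|y [Ey /= yz]].
    split; first exact: Emul.
    by move=> /(hz _ _ Ea Eb) [[]|[]].
  have [->|ym] := pselect (y = m); first exact: setmul_in.
  by rewrite -(cube y Ey); apply: setmul_in => //; exact: sqN'.
have N'N : N' ** N = N'.
  apply/seteqP; split=> [_ [a [b [[Ea /= am] [Eb /= bz] ->]]]|y [Ey /= ym]].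
    split; first exact: Emul.
    move=> /= abm; have : z * a * b = z by rewrite -mulA abm.
    move/(hz _ _ (Emul Ez Ea) Eb) => [[za _]|[_ ?]] //.
    by case: (hz z a Ez Ea za) => [[_ ?]|[/zzz]].
  have [->|yz] := pselect (y = z); first by rewrite -zm; exact: setmul_in.
  by rewrite -(cube y Ey); apply: setmul_in => //; exact: sqN.
have NN' : N ** N' = N'.
  apply/seteqP; split=> [_ [a [b [[Ea /= az] [Eb /= bm] ->]]]|y [Ey /= ym]].
    split; first exact: Emul.
    move=> /= abm; have : a * (b * z) = z by rewrite mulA abm.
    move/(hz _ _ Ea (Emul Eb Ez)) => [[? _]|[_ bz]] //.
    by case: (hz b z Eb Ez bz) => [[_ /zzz]|[]].
  have [->|yz] := pselect (y = z); first by rewrite -mz; exact: setmul_in.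
  by rewrite -(cube' y Ey); apply: setmul_in => //; exact: sqN.
have ENE : E ** N = E /\ N ** E = E /\ E ** N' = E /\ N' ** E = E.
  do !split; apply/seteqP; split=> [_ [a [b [? ? ->]]]|y Ey]; try by [apply: Emul; auto].
  - by rewrite -(cube y Ey); apply: setmul_in => //; exact: sqN.
  - by rewrite -(cube' y Ey); apply: setmul_in => //; exact: sqN.
  - have [->|yz] := pselect (y = z); first by rewrite -mz; exact: setmul_in.
    have [->|ym] := pselect (y = m); first exact: setmul_in.
    by rewrite -(cube y Ey); apply: setmul_in => //; exact: sqN'.
  - have [->|yz] := pselect (y = z); first by rewrite -zm; exact: setmul_in.
    have [->|ym] := pselect (y = m); first exact: setmul_in.
    by rewrite -(cube' y Ey); apply: setmul_in => //; exact: sqN'.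
case: ENE => EN [NE' [EN' N'E']].
have cN : cover N.
  move=> W WW WN NW WE EW.
  have sWE : W `<=` E by move=> w; rewrite -WN -WE => h; apply: setmulS h.
  have Wz w u : W w -> E u -> w * u = z -> W z \/ W m.
    by move=> Ww Eu /(hz _ _ (sWE _ Ww) Eu) [[<- _]|[wm _]]; [left|right; rewrite /m -wm].
  have Wm : W m.
    have : (W ** E) z by rewrite WE.
    move=> [w [u [Ww Eu /esym/(Wz _ _ Ww Eu) [Wz'|//]]]].
    by rewrite -WW; exact: setmul_in.
  have sNW : N `<=` W.
    move=> y [Ey /= yz]; have : (W ** E) y by rewrite WE.
    move=> [w [u [Ww Eu ywu]]].
    (* A prime [y = w * u] is [w] or [u], and [W ** N = W] settles the latter. Otherwise [y] is the
       square of an [x] of order two, and factoring [x] in [W ** E] puts [x] or [x * x] into [W]. *)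
    case: (sqirr_cases irrE Ey) => [py|[x [[Ex xx _ hx] yxx]]].
      case: (py w u (sWE _ Ww) Eu (esym ywu)) => [<-//|uy].
      by rewrite ywu uy -WN; apply: setmul_in.
    have : (W ** E) x by rewrite WE.
    move=> [v [t [Wv Et /esym xvt]]].
    case: (hx v t (sWE _ Wv) Et xvt) => [[vx _]|[vx _]]; last by rewrite yxx -vx.
    by rewrite yxx -vx -WW; exact: setmul_in.
  have [Wzz|Wzz] := pselect (W z); [right|left]; apply/seteqP; split=> // y.
    by have [->//|yz] := pselect (y = z) => Ey; apply: sNW.
  by move=> Wy; split; [exact: sWE|move=> /= yz; apply: Wzz; rewrite -yz].
pose F := bwd p N; pose F' := bwd p N'.
have be : bwd p E = [set e] by rewrite /E fwdK.
have FF : F ** F = F by rewrite /F -bwdM NN.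
have F'F' : F' ** F' = F by rewrite /F /F' -bwdM N'N'.
have F'F : F' ** F = F' by rewrite /F /F' -bwdM N'N.
have FF' : F ** F' = F' by rewrite /F /F' -bwdM NN'.
have Fe : F ** [set e] = [set e] by rewrite -be /F -bwdM NE'.
have eF : [set e] ** F = [set e] by rewrite -be /F -bwdM EN.
have F'e : F' ** [set e] = [set e] by rewrite -be /F' -bwdM N'E'.
have eF' : [set e] ** F' = [set e] by rewrite -be /F' -bwdM EN'.
have NF : N <> N' by move=> h; have := Nz; rewrite -h => -[_]; apply.
have : F `|` F' = F \/ F `|` F' = [set e].
  apply: (cover_bwd cN).
  - by rewrite setmulUl !setmulUr FF FF' F'F F'F' (setUC F' F) setUid.
  - by rewrite -/F setmulUl FF F'F.
  - by rewrite -/F setmulUr FF FF'.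
  - by rewrite setmulUl Fe F'e setUid.
  - by rewrite setmulUr eF eF' setUid.
have FF'_ : F `|` F' = F -> F = F'.
  move=> h; have F'sF : F' `<=` F by rewrite -h; right.
  apply/seteqP; split=> //.
  by have := @setmulS S F' F' F' F (fun _ h => h) F'sF; rewrite F'F' F'F.
move=> [/FF'_|h]; first by move/(congr1 (fwd p)); rewrite !bwdK.
apply: NF; have n0 (A : set S) : A !=set0 -> A `<=` [set e] -> A = [set e].
  move=> [x Ax] Ae; apply/seteqP; split=> // y ->; by have <- := Ae _ Ax.
have Fe1 : F = [set e].
  apply: n0; last by rewrite -h; left.
  by apply: (fwd_n0 (power_iso_sym p)); exists m.
have Fe2 : F' = [set e].
  apply: n0; last by rewrite -h; right.
  by apply: (fwd_n0 (power_iso_sym p)); exists z.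
by rewrite -(bwdK p N) -/F Fe1 -Fe2 /F' bwdK.
Qed.

Lemma Psi_quasitrivial a b : E a -> E b -> a * b = a \/ a * b = b.
Proof.
move=> Ea Eb; case: (sqirr_cases irrE (Emul Ea Eb)) => [h|[z [/no_inv2 []]]].
by case: (h a b) => // h'; [left|right].
Qed.

Let qt := Psi_quasitrivial.

Let idE a : E a -> a * a = a.
Proof. by move=> Ea; case: (qt Ea Ea). Qed.

Let bwdE : bwd p E = [set e]. Proof. exact: fwdK. Qed.

(** The elements [u] and [u'] restore [m] in [Z ** E] and [E ** Z]. As [Z] covers [E], adding [e] to
    the preimage of [Z] yields that preimage or [{e}]; both possibilities put [e] into the
    preimage. *)
Let minus m u u' : E m -> E u -> u <> m -> u * m = m ->
    E u' -> u' <> m -> m * u' = m ->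
  let Z := E `\ m in [/\ Z ** Z = Z, Z ** E = E, E ** Z = E, cover Z & bwd p Z e].
Proof.
move=> Em Eu um umm Eu' um' mum Z.
have ZE a : Z a -> E a by case.
have ZZ : Z ** Z = Z.
  apply/seteqP; split=> [_ [a [b [Za Zb ->]]]|y Zy].
    by case: (qt (ZE _ Za) (ZE _ Zb)) => ->.
  by rewrite -(idE (ZE _ Zy)); exact: setmul_in.
have ZE' : Z ** E = E.
  apply/seteqP; split=> [_ [a [b [Za Eb ->]]]|y Ey]; first by apply: Emul; auto.
  have [->|ym] := pselect (y = m); first by rewrite -umm; exact: setmul_in.
  by rewrite -(idE Ey); exact: setmul_in.
have EZ : E ** Z = E.
  apply/seteqP; split=> [_ [a [b [Ea Zb ->]]]|y Ey]; first by apply: Emul; auto.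
  have [->|ym] := pselect (y = m); first by rewrite -mum; exact: setmul_in.
  by rewrite -(idE Ey); exact: setmul_in.
have cZ : cover Z.
  move=> W WW WZ ZW WE EW.
  have sWE : W `<=` E.
    by move=> w; rewrite -{1}WZ -WE; apply: setmulS => // x; apply: ZE.
  have sZW : Z `<=` W.
    move=> y Zy; have : (W ** E) y by rewrite WE; apply: ZE.
    move=> [w [v [Ww Ev ywv]]].
    case: (qt (sWE _ Ww) Ev) => h; first by rewrite ywv h.
    by have yv : y = v by [rewrite ywv]; rewrite -WZ ywv; apply: setmul_in => //; rewrite -yv.
  have [Wm|Wm] := pselect (W m); [right|left]; apply/seteqP; split=> // y.
    by have [->//|ym] := pselect (y = m) => Ey; apply: sZW.
  by move=> Wy; split; [exact: sWE|move=> /= yz; apply: Wm; rewrite -yz].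
split=> //; pose F := bwd p Z.
have FF : F ** F = F by rewrite /F -bwdM ZZ.
have Fe : F ** [set e] = [set e] by rewrite -bwdE /F -bwdM ZE'.
have eF : [set e] ** F = [set e] by rewrite -bwdE /F -bwdM EZ.
have ee1 : [set e] ** [set e] = [set e] by rewrite setmul1 ee.
have : F `|` [set e] = F \/ F `|` [set e] = [set e].
  apply: (cover_bwd cZ).
  - by rewrite setmulUl !setmulUr FF Fe eF ee1 setUid -setUA setUid.
  - by rewrite -/F setmulUl FF eF.
  - by rewrite -/F setmulUr FF Fe.
  - by rewrite setmulUl Fe ee1 setUid.
  - by rewrite setmulUr eF ee1 setUid.
move=> [hF|h]; first by rewrite -/F -hF; right.
have : F !=set0 by apply: (fwd_n0 (power_iso_sym p)); exists u.
move=> [x Fx]; have : [set e] x by rewrite -h; left.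
by move=> /= <-.
Qed.

(** Here [e] is a zero of [F], so it is not the square of an element of order two. Hence it is
    prime, and other elements of [F] never multiply to [e]. *)
Let F_props (F : set S) : F ** [set e] = [set e] -> [set e] ** F = [set e] ->
  sqirr F -> F e -> (exists2 x, F x & x <> e) ->
  let F1 := F `\ e in F1 ** F1 = F1 /\ F1 !=set0.
Proof.
move=> Fe eF irrF F_e [x Fx xe] F1.
have fe y : F y -> y * e = e.
  by move=> Fy; have : (F ** [set e]) (y * e) by [exact: setmul_in]; rewrite Fe.
have ef y : F y -> e * y = e.
  by move=> Fy; have : ([set e] ** F) (e * y) by [exact: setmul_in]; rewrite eF.
split; last by exists x.
apply/seteqP; split=> [_ [a [b [[Fa /= ae] [Fb /= be] ->]]]|y [Fy /= ye]].
  split; first exact: sqirr_mul.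
  move=> /= abe; case: (sqirr_cases irrF F_e) => [/(_ a b Fa Fb abe) []//|].
  move=> [z [[Fz zz zzi _] ezz]]; apply: zz.
  by rewrite -{1}(locr z) -(idem_sqr zzi) -ezz; exact: fe.
have yyy := sqirr_cube irrF Fy; rewrite -yyy; apply: setmul_in; split=> //.
  exact: sqirr_mul.
by move=> /= yye; apply: ye; rewrite -yyy yye fe.
Qed.

(** Deleting the lower element [m] leaves a cover [Z] of [E]; its preimage [F] has [e] as a zero and
    other elements besides. Deleting [e] from [F] leaves a cover [F1] of [F], with image [U]. The
    union of [U] and [Z] is then [Z] or [U], and each case is refuted. *)
Let no_chain h m : E h -> E m -> h <> m -> h * m = m -> m * h = m -> False.
Proof.
move=> Eh Em hm hmm mhm.
have [] := minus Em Eh hm hmm Eh hm mhm.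
set Z := E `\ m => ZZ ZE EZ cZ; set F := bwd p Z => F_e.
have Zh : Z h by [].
have sZE : Z `<=` E by move=> x [].
have ZnE : Z <> E by move=> ZE'; have : E m := Em; rewrite -ZE' => -[_]; apply.
have FF : F ** F = F by rewrite /F -bwdM ZZ.
have Fe : F ** [set e] = [set e] by rewrite -bwdE /F -bwdM ZE.
have eF : [set e] ** F = [set e] by rewrite -bwdE /F -bwdM EZ.
have ee1 : [set e] ** [set e] = [set e] by rewrite setmul1 ee.
have irrF : sqirr F.
  split=> // Y YF YY.
  have FY : Y ** F = F.
    apply/seteqP; split; first by rewrite -{2}FF; apply: setmulS.
    by rewrite -{1}YY; apply: setmulS.
  pose X := fwd p Y; have XX : X ** X = Z by rewrite /X -fwdM YY bwdK.
  have XZ : X ** Z = Z by rewrite /X -(bwdK p Z) -/F -fwdM FY.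
  have sXZ : X `<=` Z.
    move=> x Xx; have Zxx : Z (x * x) by rewrite -XX; exact: setmul_in.
    have <- : x * (x * x) = x by rewrite idem_sqr ?locr // /idem; apply/idE/sZE.
    by rewrite -XZ; exact: setmul_in.
  apply: (@fwd_inj _ _ p); rewrite bwdK -/X; apply/seteqP; split=> // z.
  rewrite -{1}XX => -[x [y [Xx Xy ->]]].
  by case: (qt (sZE _ (sXZ _ Xx)) (sZE _ (sXZ _ Xy))) => ->.
have [x Fx xe] : exists2 x, F x & x <> e.
  apply: contrapT => nx; apply: ZnE; rewrite -(bwdK p Z) -/F /E; congr fwd.
  apply/seteqP; split=> [x Fx|x ->//]; apply: contrapT => xe.
  by apply: nx; exists x.
have [] := F_props Fe eF irrF F_e (ex_intro2 _ _ x Fx xe).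
set F1 := F `\ e => F1F1 F1n0.
have FF1 : F = F1 `|` [set e] by rewrite /F1 setUC setD1K.
have fe y : F y -> y * e = e.
  by move=> Fy; have : (F ** [set e]) (y * e) by [exact: setmul_in]; rewrite Fe.
have ef y : F y -> e * y = e.
  by move=> Fy; have : ([set e] ** F) (e * y) by [exact: setmul_in]; rewrite eF.
have F1e : F1 ** [set e] = [set e].
  apply/seteqP; split=> [y /setmul1r[z [Fz _] ->]|y ->]; first by rewrite fe.
  case: F1n0 => z F1z; apply/setmul1r; exists z => //; rewrite fe //; exact: F1z.1.
have eF1 : [set e] ** F1 = [set e].
  apply/seteqP; split=> [y /setmul1l[z [Fz _] ->]|y ->]; first by rewrite ef.
  case: F1n0 => z F1z; apply/setmul1l; exists z => //; rewrite ef //; exact: F1z.1.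
have F1F : F1 ** F = F by rewrite {1}FF1 setmulUr F1F1 F1e -FF1.
have FF1' : F ** F1 = F by rewrite {1}FF1 setmulUl F1F1 eF1 -FF1.
have F1nF : F1 <> F by move=> h1; have := F_e; rewrite -h1 => -[_]; apply.
pose U := fwd p F1.
have UU : U ** U = U by rewrite /U -fwdM F1F1.
have UZ : U ** Z = Z by rewrite /U -(bwdK p Z) -/F -fwdM F1F.
have ZU : Z ** U = Z by rewrite /U -(bwdK p Z) -/F -fwdM FF1'.
have UnZ : U <> Z by rewrite /U -(bwdK p Z) -/F => /fwd_inj.
have cU W : W ** W = W -> W ** F1 = W -> F1 ** W = W -> W ** F = F ->
    W = F \/ W = F1.
  move=> WW WF1 F1W WF.
  have We : W ** [set e] = [set e] by rewrite -Fe setmulA WF.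
  have hW : W `|` [set e] = F1 `|` [set e].
    by have := WF; rewrite FF1 setmulUr WF1 We.
  have [We'|We'] := pselect (W e); [left|right].
    by rewrite FF1 -hW; apply/seteqP; split=> [y|y [//|->//]]; left.
  apply/seteqP; split=> y hy.
    have : (F1 `|` [set e]) y by rewrite -hW; left.
    by move=> [//|/= ye]; case: We'; rewrite -ye.
  have : (W `|` [set e]) y by rewrite hW; left.
  by move=> [//|/= ye]; case: hy => _ /(_ ye).
have : bwd p (U `|` Z) = F \/ bwd p (U `|` Z) = F1.
  have h1 : (U `|` Z) ** (U `|` Z) = U `|` Z.
    by rewrite setmulUl !setmulUr UU UZ ZU ZZ setUid -setUA setUid.
  apply: cU.
  - by rewrite -bwdM h1.
  - by rewrite -{1}(fwdK p F1) -bwdM -/U setmulUl UU ZU.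
  - by rewrite -{1}(fwdK p F1) -bwdM -/U setmulUr UU UZ.
  - by rewrite -bwdM setmulUl UZ ZZ setUid.
move=> [/(congr1 (fwd p))|/(congr1 (fwd p))]; rewrite !bwdK => UZ'.
(* A point [m2] of [Z] outside [U] can be deleted from [E] as well. The preimage of the resulting
   [Z2] is absorbed by [F1] and by [e], so [Z ** Z2 = Z2]; but [m2 = m2 * v] lies in this
   product. *)
- have sUZ : U `<=` Z by rewrite -UZ'; left.
  have [m2 [Zm2 Um2]] : exists m2, Z m2 /\ ~ U m2.
    apply: contrapT => /forallNP nm; apply: UnZ; apply/seteqP; split=> // y Zy.
    by apply: contrapT => Uy; apply: (nm y).
  have Em2 := sZE _ Zm2.
  have [u [Uu um2]] : exists u, U u /\ u * m2 = m2.
    have : (U ** Z) m2 by rewrite UZ.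
    move=> [u [z [Uu Zz uz]]]; exists u; split=> //.
    case: (qt (sZE _ (sUZ _ Uu)) (sZE _ Zz)) => h'; last by rewrite uz h' h'.
    by case: Um2; rewrite uz h'.
  have [v [Uv m2v]] : exists v, U v /\ m2 * v = m2.
    have : (Z ** U) m2 by rewrite ZU.
    move=> [z [v [Zz Uv zv]]]; exists v; split=> //.
    case: (qt (sZE _ Zz) (sZE _ (sUZ _ Uv))) => h'; first by rewrite zv h' h'.
    by case: Um2; rewrite zv h'.
  have um : u <> m2 by move=> h'; apply: Um2; rewrite -h'.
  have vm : v <> m2 by move=> h'; apply: Um2; rewrite -h'.
  have [] := minus Em2 (sZE _ (sUZ _ Uu)) um um2 (sZE _ (sUZ _ Uv)) vm m2v.
  set Z2 := E `\ m2 => Z2Z2 Z2E EZ2 cZ2; set F2 := bwd p Z2 => F2e.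
  have sUZ2 : U `<=` Z2.
    by move=> y Uy; split; [apply/sZE/sUZ|move=> /= ym; apply: Um2; rewrite -ym].
  have [w [Uw wm]] : exists w, U w /\ w * m = m.
    have : (U ** Z) h by rewrite UZ.
    move=> [w [z [Uw Zz hwz]]]; exists w; split=> //.
    case: (qt (sZE _ (sUZ _ Uw)) (sZE _ Zz)) => h'; first by rewrite -h' -hwz.
    have wh : w * h = h by rewrite hwz h' h'.
    by rewrite -hmm mulA wh.
  have UZ2 : U ** Z2 = Z2.
    apply/seteqP; split=> [_ [a [b [Ua Zb ->]]]|y Zy].
      by rewrite -Z2Z2; apply: setmul_in => //; apply: sUZ2.
    have [->|ym] := pselect (y = m); first by rewrite -wm; apply: setmul_in => //; split=> // /= mm2; case: Zm2 => _; apply.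
    have : (U ** Z) y by rewrite UZ; split=> //; exact: Zy.1.
    move=> [a [b [Ua Zb yab]]].
    have ay : a * y = y.
      by rewrite yab mulA; congr (_ * _); apply/idE/sZE/sUZ.
    by rewrite -ay; exact: setmul_in.
  have F1F2 : F1 ** F2 = F2 by rewrite /F2 -{1}(fwdK p F1) -bwdM -/U UZ2.
  have FF2 : F ** F2 = F2.
    rewrite FF1 setmulUl F1F2; apply/seteqP; split=> [y [//|/setmul1l[z F2z ->]]|]; last by left.
    suff : ([set e] ** F2) (e * z) by rewrite -bwdE /F2 -bwdM EZ2 bwdE => ->.
    exact: setmul_in.
  have ZZ2 : Z ** Z2 = Z2 by rewrite -(bwdK p Z) -(bwdK p Z2) -/F -/F2 -fwdM FF2.
  have : Z2 m2 by rewrite -ZZ2 -m2v; apply: setmul_in => //; apply: sUZ2.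
  by move=> [_]; apply.
(* Now [m] is not in [U]. Since [Z] covers [E], adding [e] to the preimage [G] of the union of [U]
   and [E] gives [F] or [{e}], so [G] is [F], [F1] or [{e}]. The first two put [m] into [Z] or [U];
   the third gives [U = Z]. *)
- rewrite -/U in UZ'; have sZU : Z `<=` U by rewrite -UZ'; right.
  have Um : U m -> False.
    by move=> Um; have : Z m by [rewrite -UZ -mhm; exact: setmul_in]; case=> _; apply.
  have UE : U ** E = E by rewrite -ZE setmulA UZ.
  have EU : E ** U = E by rewrite -EZ -setmulA ZU.
  pose G := bwd p (U `|` E); have hU : bwd p U = F1 by rewrite /U fwdK.
  have EE' : E ** E = E by exact: EE.
  have F1G : F1 ** G = G by rewrite /G -hU -bwdM setmulUr UU UE.
  have GF1 : G ** F1 = G by rewrite /G -hU -bwdM setmulUl UU EU.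
  have GG : G ** G = G.
    by rewrite /G -bwdM setmulUl !setmulUr UU UE EU EE' setUid -setUA setUid.
  have Ge : G ** [set e] = [set e] by rewrite -bwdE /G -bwdM setmulUl UE EE' setUid.
  have eG : [set e] ** G = [set e] by rewrite -bwdE /G -bwdM setmulUr EU EE' setUid.
  have : G `|` [set e] = F \/ G `|` [set e] = [set e].
    apply: (cover_bwd cZ); rewrite -/F.
    - by rewrite setmulUl !setmulUr GG Ge eG ee1 setUid -setUA setUid.
    - by rewrite setmulUl FF1 !setmulUr GF1 Ge eF1 ee1 setUid -setUA setUid.
    - by rewrite setmulUr FF1 !setmulUl F1G eG F1e ee1 setUid -setUA setUid.
    - by rewrite setmulUl Ge ee1 setUid.
    - by rewrite setmulUr eG ee1 setUid.
  have Gn0 : G !=set0 by apply: (fwd_n0 (power_iso_sym p)); exists m; right.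
  have [Gm Gm'] : fwd p G m /\ fwd p G = U `|` E by rewrite /G bwdK; split=> //; right.
  move=> [GF|Ge'].
    have [G_e|G_e] := pselect (G e).
      have GeF : G = F by rewrite -GF; apply/seteqP; split=> [y|y [//|->//]]; left.
      by have : Z m by [rewrite -(bwdK p Z) -/F -GeF]; case=> _; apply.
    have GeF : G = F1.
      rewrite /F1 -GF; apply/seteqP; split=> y.
        by move=> Gy; split; [left|move=> /= ye; apply: G_e; rewrite -ye].
      by move=> [[//|/= ->]] /(_ erefl).
    by apply: Um; rewrite /U -GeF.
  have G1 : G = [set e].
    by case: Gn0 => g Gg; apply/seteqP; split=> [y Gy|y ->];
      [rewrite -Ge'; left|have : [set e] g by [rewrite -Ge'; left]; move=> /= <-].
  have UsE : U `<=` E.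
    by move: Gm'; rewrite G1 -/E => ->; left.
  apply: UnZ; apply/seteqP; split=> // y Uy; split; first exact: UsE.
  by move=> /= ym; apply: Um; rewrite -ym.
Qed.

(** Without chains, every two elements form a left zero or a right zero pair. A right zero pair [a],
    [b] and a left zero pair [c], [d] cannot coexist: [key] excludes a common element, and
    associativity either reduces the other cases to it or contradicts the choice of a pair. *)
Theorem Psi_left_or_right_zero : left_zero E \/ right_zero E.
Proof.
have LR a b : E a -> E b -> (a * b = a /\ b * a = b) \/ (a * b = b /\ b * a = a).
  move=> Ea Eb; have [->|ab] := pselect (a = b); first by left; rewrite !idE.
  case: (qt Ea Eb) => h1; case: (qt Eb Ea) => h2; [by left| | |by right].
    by case: (@no_chain b a) => //; apply/nesym.
  by case: (@no_chain a b).
apply: contrapT => /not_orP[/existsNP[a /existsNP[b]] nL /existsNP[c /existsNP[d]] nR].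
move/not_implyP: nL => [Ea /not_implyP[Eb ab]].
move/not_implyP: nR => [Ec /not_implyP[Ed cd]].
case: (LR a b Ea Eb) => [[]//|[ab1 ba1]].
case: (LR c d Ec Ed) => [[cd1 dc1]|[]//].
have key : c = a -> False.
  move=> ca; subst c; case: (LR b d Eb Ed) => [[bd db]|[bd db]].
    by apply: ab; rewrite -[X in X * b]cd1 -mulA db.
  by apply: cd; rewrite -{1}bd mulA ab1.
case: (LR a c Ea Ec) => [[ac ca]|[ac ca]].
- case: (LR b c Eb Ec) => [[bc cb]|[bc cb]].
    by apply: ab; rewrite -{1}ac -mulA cb.
  by apply: key; rewrite -bc -ab1 -mulA bc.
- case: (LR a d Ea Ed) => [[ad da]|[ad da]].
    by apply: key; rewrite -ac -ad -mulA dc1.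
  by apply: cd; rewrite -{1}ad mulA ca.
Qed.

End Quasitrivial.

Lemma zero_jle (S : crsemigroup) (A : set S) a b :
  left_zero A \/ right_zero A -> A a -> A b -> jle a b.
Proof.
by move=> [h|h] Aa Ab; [rewrite -(h a b)//; exact: jle_mulr|rewrite -(h b a)//; exact: jle_mull].
Qed.

Lemma left_zero_mulr (S : crsemigroup) (X E : set S) i x :
  left_zero E -> E ** X = E -> E i -> X x -> i * x = i.
Proof.
move=> LE EX Ei Xx; have Eix : E (i * x) by rewrite -EX; exact: setmul_in.
by rewrite -[RHS](LE _ _ Ei Eix) mulA (LE i i).
Qed.

(** For [y] in [X], below [i] like [x], the equation [i * y = i] gives [y = y * i] by stability, and
    this lies in [X ** E = E]. *)
Lemma left_zero_absorb (S : crsemigroup) (X E : set S) i x :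
    left_zero E -> left_zero X \/ right_zero X -> X ** E = E -> E ** X = E ->
  X x -> E i -> jle x i -> X = E.
Proof.
move=> LE ZX XE EX Xx Ei xi.
have sXE : X `<=` E.
  move=> y Xy; have yi : jle y i by apply: (jle_trans (zero_jle ZX Xy Xx)).
  have := jle_loc_mulr yi; rewrite (left_zero_mulr LE EX Ei Xy) loc_id; last exact: LE.
  by move=> <-; rewrite -XE; exact: setmul_in.
apply/seteqP; split=> // j; rewrite -{1}XE => -[y [k [Xy Ek ->]]].
by rewrite LE //; exact: sXE.
Qed.

Section Psi.
Variables (S T : crsemigroup) (p : power_iso S T).

Definition Psi a := fwd p [set a].

Lemma PsiM a b : Psi (a * b) = Psi a ** Psi b.
Proof. by rewrite /Psi -fwdM setmul1. Qed.

Lemma Psi_n0 a : Psi a !=set0.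
Proof. by apply: fwd_n0; exists a. Qed.

Lemma Psi_inj a b : Psi a = Psi b -> a = b.
Proof. by move/fwd_inj=> h; have : [set b] a by rewrite -h. Qed.

Lemma Psi_zero e : idem e -> left_zero (Psi e) \/ right_zero (Psi e).
Proof. exact: Psi_left_or_right_zero. Qed.

End Psi.

(** * An idempotent strictly below another one *)

Section Below.
Variables (S T : crsemigroup) (p : power_iso S T) (e x : S).
Hypotheses (ee : idem e) (xx : idem x) (xe : x * e = e) (ex : e * x = e).
Hypothesis e_x : e <> x.

Let E := Psi p e.
Let X := Psi p x.
Hypothesis LE : left_zero E.

Let EE : E ** E = E. Proof. by rewrite /E -PsiM ee. Qed.
Let XX : X ** X = X. Proof. by rewrite /X -PsiM xx. Qed.
Let XE : X ** E = E. Proof. by rewrite /X /E -PsiM xe. Qed.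
Let EX : E ** X = E. Proof. by rewrite /X /E -PsiM ex. Qed.
Let bX : bwd p X = [set x]. Proof. exact: fwdK. Qed.
Let bE : bwd p E = [set e]. Proof. exact: fwdK. Qed.

Let XnE x' i : X x' -> E i -> ~ jle x' i.
Proof.
move=> Xx' Ei /(left_zero_absorb LE (Psi_zero p xx) XE EX Xx' Ei).
by move/Psi_inj/esym.
Qed.

Let G := bwd p (X `|` E).

Let BX (B : set T) : B `<=` E -> B ** X = B.
Proof.
move=> sBE; have h b y : B b -> X y -> b * y = b.
  by move=> /sBE; apply: left_zero_mulr EX.
have [y Xy] := Psi_n0 p x.
apply/seteqP; split=> [_ [b [z [Bb Xz ->]]]|b Bb]; first by rewrite h.
by rewrite -(h b y) //; exact: setmul_in.
Qed.

Let BE (B : set T) : B `<=` E -> B ** E = B.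
Proof.
move=> sBE; have [y Ey] := Psi_n0 p e.
apply/seteqP; split=> [_ [b [z [Bb Ez ->]]]|b Bb]; first by rewrite LE //; apply: sBE.
by rewrite -(LE (sBE _ Bb) Ey); exact: setmul_in.
Qed.

(** Together with [B_of_U] this describes the sets [X] union [B], for [B] inside [E], by equations
    between sets alone, which therefore pass through [p]. *)
Let U_of_B (B : set T) : B `<=` E ->
  (X `|` B) ** X = X `|` B /\ (X `|` B) ** (X `|` E) = X `|` E.
Proof.
move=> sBE; rewrite setmulUl XX BX //; split=> //.
rewrite setmulUl !setmulUr XX XE BX // BE // setUid -setUA; congr (_ `|` _).
by apply/seteqP; split=> [y [//|/sBE]|y]; [|left].
Qed.

Let B_of_U (U : set T) : U ** X = U -> U ** (X `|` E) = X `|` E ->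
  exists2 B, B `<=` E & U = X `|` B.
Proof.
move=> UX UXE; rewrite setmulUr UX in UXE; exists (U `&` E); first by move=> y [].
apply/seteqP; split=> y.
  move=> Uy; have : (X `|` E) y by rewrite -UXE; left.
  by move=> [Xy|Ey]; [left|right].
move=> [Xy|[]//]; have : (X `|` E) y by left.
rewrite -UXE => -[//|[u [i [Uu Ei yui]]]].
by case: (XnE Xy Ei); rewrite yui; exact: jle_mulr.
Qed.

Let GG : G ** G = G.
Proof. by rewrite /G -bwdM setmulUl !setmulUr XX XE EX EE setUid -setUA setUid. Qed.
Let Gx : G ** [set x] = G.
Proof. by rewrite -bX /G -bwdM setmulUl XX EX. Qed.
Let xG : [set x] ** G = G.
Proof. by rewrite -bX /G -bwdM setmulUr XX XE. Qed.
Let Ge : G ** [set e] = [set e].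
Proof. by rewrite -bE /G -bwdM setmulUl XE EE setUid. Qed.
Let eG : [set e] ** G = [set e].
Proof. by rewrite -bE /G -bwdM setmulUr EX EE setUid. Qed.

(** The pair [V = {x, g}] satisfies the equations of [B_of_U], and this forces
    [V ** V ** V = V ** V], so that [g] has very few powers. If an element of the image of [loc g]
    lies below [E], then [loc g = e] and [g = e]. Otherwise [g] is idempotent and [B] is empty,
    whence [g = x]. *)
Let G_xe g : G g -> g = x \/ g = e.
Proof.
move=> Gg.
have gx : g * x = g.
  by have := Gg; rewrite -{1}Gx => /setmul1r[h _ ->]; rewrite -mulA xx.
have xg : x * g = g.
  by have := Gg; rewrite -{1}xG => /setmul1l[h _ ->]; rewrite mulA xx.
have ge : g * e = e.
  by have : (G ** [set e]) (g * e) by [exact: setmul_in]; rewrite Ge.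
have eg : e * g = e.
  by have : ([set e] ** G) (e * g) by [exact: setmul_in]; rewrite eG.
pose f := loc g; pose V := [set x] `|` [set g].
have VG : V ** G = G.
  rewrite setmulUl xG; apply/seteqP; split=> [y [//|/setmul1l[z Gz ->]]|]; last by left.
  by rewrite -GG; exact: setmul_in.
have Vx : V ** [set x] = V by rewrite setmulUl !setmul1 xx gx.
have [B sBE VB] : exists2 B, B `<=` E & fwd p V = X `|` B.
  apply: B_of_U; first by rewrite /X /Psi -fwdM Vx.
  by rewrite -(bwdK p (X `|` E)) -/G -fwdM VG.
pose C := B `|` (X ** B).
have sCE : C `<=` E.
  by move=> y [/sBE//|h]; rewrite -XE; apply: setmulS h.
have BB (D : set T) : D `<=` E -> D ** B `<=` D.
  by move=> sDE _ [d [b [Dd /sBE Eb ->]]]; rewrite LE //; apply: sDE.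
have VV : fwd p (V ** V) = X `|` C.
  rewrite fwdM VB setmulUl !setmulUr XX BX // /C; apply/seteqP; split=> y.
    by move=> [[|]|[|/(BB _ sBE)]]; [left|right; right|right; left|right; left].
  by move=> [|[|]]; [left; left|right; left|left; right].
have VVV : V ** V ** V = V ** V.
  apply: (@fwd_inj _ _ p); rewrite fwdM VV VB setmulUl !setmulUr XX BX //.
  apply/seteqP; split=> y.
    by move=> [[|]|[|/(BB _ sCE)]]; [left|right; right|right|right].
  by move=> [|]; [left; left|right; left].
have ggg : g * (g * g) = x \/ g * (g * g) = g \/ g * (g * g) = g * g.
  have : (V ** V ** V) (g * (g * g)).
    by rewrite mulA; do 2?apply: setmul_in; right.
  rewrite VVV setmulUl !setmulUr !setmul1 xx xg gx => -[[|]|[|]] /= ->; auto.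
have xf : x * f = f by rewrite /f /loc mulA xg.
have gf : g * f = g by exact: locr.
have fg : f * g = g by exact: locl.
have ff : idem f by exact: loc_idem.
have fe : f * e = e by rewrite -ge mulA fg.
have ef : e * f = e by rewrite -eg -mulA gf.
pose Z := Psi p g; pose Z0 := Psi p f.
(* [Q] is [{f, g, g * g}], stable under left multiplication by [g]. Comparing images confines [Z] to
   [Z0] and to products [C ** Z0], which lie below [E]. *)
pose Q := V ** V ** [set f].
have QE : Q = [set f] `|` ([set g] `|` [set g * g]).
  rewrite /Q setmulUl !setmulUr !setmulUl !setmul1 xx xg gx xf gf -mulA gf setUA -(setUA [set f]).
  by rewrite setUid setUA.
have gQ : [set g] ** Q = Q.
  have hinv : inv g * g = f by rewrite -mulC_inv.
  rewrite QE !setmulUr !setmul1 gf; case: ggg => [h|[h|h]]; rewrite h.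
  - have -> : x = f by rewrite -xf -[in RHS]h -!mulA gf h.
    by rewrite setUA setUC.
  - have -> : g * g = f.
      by move/(congr1 (mul (inv g))): h; rewrite !mulA hinv fg.
    by apply/seteqP; split=> y /=; tauto.
  - have gg : g * g = g.
      by move/(congr1 (mul (inv g))): h; rewrite !mulA hinv fg.
    have -> : f = g by rewrite -hinv -{2}gg mulA hinv fg.
    by rewrite gg.
have Q' : fwd p Q = Z0 `|` C ** Z0.
  by rewrite /Q fwdM VV setmulUl -PsiM xf.
have sZQ : Z `<=` Z0 `|` C ** Z0.
  move=> z Zz; rewrite -Q' -gQ fwdM Q'.
  have : (Z ** Z0) z by rewrite /Z /Z0 -PsiM gf.
  by apply: setmulS => // y; left.
have Z0E : Z0 ** E = E by rewrite /Z0 /E -PsiM fe.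
have EZ0 : E ** Z0 = E by rewrite /Z0 /E -PsiM ef.
have [[z [i [Zz Ei zi]]]|nle] :=
    pselect (exists z i, [/\ Z0 z, E i & jle z i]).
  have /Psi_inj fe' := left_zero_absorb LE (Psi_zero p ff) Z0E EZ0 Zz Ei zi.
  by right; rewrite -ge -fe' gf.
left.
have sZZ0 : Z `<=` Z0.
  move=> z Zz; case: (sZQ _ Zz) => // -[c [y [Cc Z0y zcy]]].
  have [w Vw] := Psi_n0 p (inv g).
  case: nle; exists (z * w), c; split; [|exact: sCE|].
    by rewrite /Z0 /f /loc PsiM; exact: setmul_in.
  by apply: jle_trans (jle_mull _ _) _; rewrite zcy; exact: jle_mull.
have gg : g * g = g.
  apply: (@Psi_inj _ _ p); rewrite PsiM -/Z; have [z0 Zz0] := Psi_n0 p g.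
  case: (Psi_zero p ff) => h; apply/seteqP; split=> [_ [a [b [Za Zb ->]]]|z Zz].
  - by rewrite h //; exact: sZZ0.
  - by rewrite -(h _ _ (sZZ0 _ Zz) (sZZ0 _ Zz0)); exact: setmul_in.
  - by rewrite h //; exact: sZZ0.
  - by rewrite -(h _ _ (sZZ0 _ Zz0) (sZZ0 _ Zz)); exact: setmul_in.
have fgE : f = g by rewrite /f loc_id.
have B0 : B = set0.
  apply/seteqP; split=> // b Bb; have [z Zz] := Psi_n0 p g.
  have : (fwd p V ** Z) (b * z) by apply: setmul_in => //; rewrite VB; right.
  rewrite /Z /Psi -fwdM setmulUl !setmul1 xg gg setUid => h; apply: nle.
  exists (b * z), b; split; [by rewrite /Z0 fgE|exact: sBE|exact: jle_mull].
have Vx1 : V = [set x] by apply: (@fwd_inj _ _ p); rewrite VB B0 setU0.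
by have : [set x] g by rewrite -Vx1; right.
Qed.

(** [G] turns out to be [{x, e}], and so does the preimage of [X] with [k] added, for every [k] in
    [E]. As [p] is injective, [E] has a single element. *)
Lemma left_zero_below i j : E i -> E j -> i = j.
Proof.
have Ge' : G e.
  apply: contrapT => nGe; have [k Ek] := Psi_n0 p e.
  have [g Gg] : G !=set0 by apply: (fwd_n0 (power_iso_sym p)); exists k; right.
  have G1 : G = [set x].
    apply/seteqP; split=> [y Gy|y ->].
      by case: (G_xe Gy) => // ye; case: nGe; rewrite -ye.
    by case: (G_xe Gg) => gE; [rewrite -gE|case: nGe; rewrite -gE].
  have Xk : X k by rewrite /X /Psi -G1 bwdK; right.
  exact: XnE Xk Ek (jle_refl k).
have Gx' : G x.
  apply: contrapT => nGx; have [y Xy] := Psi_n0 p x.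
  have G1 : G = [set e].
    apply/seteqP; split=> [z Gz|z ->//].
    by case: (G_xe Gz) => // zx; case: nGx; rewrite -zx.
  have Ey : E y by rewrite /E /Psi -G1 bwdK; left.
  exact: XnE Xy Ey (jle_refl y).
have key k : E k -> bwd p (X `|` [set k]) = [set x] `|` [set e].
  move=> Ek; have [] := @U_of_B [set k] _; first by move=> ? ->.
  set U := bwd p _ => UX UXE.
  have Ux : U ** [set x] = U by rewrite -bX /U -bwdM UX.
  have UG : U ** G = G by rewrite /U /G -bwdM UXE.
  have Uxe u : U u -> u = x \/ u = e.
    move=> Uu; apply: G_xe; rewrite -UG -{1}(_ : u * x = u); first exact: setmul_in.
    by move: Uu; rewrite -{1}Ux => /setmul1r[v _ ->]; rewrite -mulA xx.
  have Ux' : U x.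
    have := Gx'; rewrite -{1}UG => -[u [g [Uu Gg xug]]].
    case: (Uxe _ Uu) => [<-//|ue]; case: e_x.
    by rewrite xug ue; case: (G_xe Gg) => ->.
  have Ue' : U e.
    apply: contrapT => nUe; suff Xk : X k by exact: XnE Xk Ek (jle_refl k).
    rewrite /X /Psi -(_ : U = [set x]) ?bwdK; first by right.
    apply/seteqP; split=> [u Uu|u ->//].
    by case: (Uxe _ Uu) => // ue; case: nUe; rewrite -ue.
  apply/seteqP; split=> [u /Uxe[->|->]|u [->|->]] //; [by left|by right].
move=> Ei Ej; have := key i Ei; rewrite -(key j Ej) => /(congr1 (fwd p)).
rewrite !bwdK => XiXj; have : (X `|` [set j]) i by rewrite -XiXj; right.
by move=> [Xi|//]; case: (XnE Xi Ei (jle_refl i)).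
Qed.

End Below.

(** * Green's relation R and R-maximal elements *)

Section Green.
Variable S : crsemigroup.
Implicit Types a b c e x y : S.

Lemma mul_locl x a : x * a = a -> x * loc a = loc a.
Proof. by move=> xa; rewrite /loc mulA xa. Qed.

Lemma mul_locr x a : a * x = a -> loc a * x = loc a.
Proof. by move=> ax; rewrite /loc mulC_inv -mulA ax. Qed.

Lemma mul_locl_inv x a : x * a = a -> loc x * a = a.
Proof. by move=> xa; rewrite -{1}xa mulA locl. Qed.

(* Green's relation R. *)
Definition Req a b := loc a * b = b /\ loc b * a = a.

Lemma Req_refl a : Req a a.
Proof. by split; exact: locl. Qed.

Lemma Req_sym a b : Req a b -> Req b a.
Proof. by case. Qed.

Lemma Req_trans b a c : Req a b -> Req b c -> Req a c.
Proof.
move=> [ab ba] [bc cb]; split.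
  by rewrite -bc mulA (mul_locl ab).
by rewrite -ba mulA (mul_locl cb).
Qed.

Lemma Req_loc a : Req a (loc a).
Proof. by split; [exact: loc_idem|rewrite loc_id ?locl //; exact: loc_idem]. Qed.

Lemma Req_jle a b : Req a b -> jle a b.
Proof.
move=> [_ ba]; rewrite -ba; apply: jle_trans (jle_mull _ _) _; exact: loc_jle.
Qed.

Lemma Req_mul a b : jle a b -> Req a (a * b).
Proof. by move=> ab; split; [exact: loc_mull|exact: jle_loc_mul]. Qed.

Lemma Req_idem e f : idem e -> idem f -> Req e f <-> e * f = f /\ f * e = e.
Proof. by move=> ee ff; rewrite /Req !loc_id. Qed.

(* [a] is R-maximal: it is not fixed on the left by any element lying strictly
   above it. *)
Definition Rmax a := forall x, x * a = a -> jle x a.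

Lemma Rmax_Req a b : Req a b -> Rmax a -> Rmax b.
Proof.
move=> ab Ra x xb; apply: (jle_trans _ (Req_jle ab)); apply: Ra.
by rewrite -ab.2 mulA (mul_locl xb).
Qed.

End Green.

Section PsiTypes.
Variables (S T : crsemigroup) (p : power_iso S T).

Lemma right_zero_Req (e d : S) : e * d = d -> d * e = e ->
  right_zero (Psi p d) -> right_zero (Psi p e).
Proof.
move=> ed de RD i j Ei Ej; have [d1 Dd1] := Psi_n0 p d.
have dj y : Psi p d y -> y * j = j.
  move=> Dy; have : (Psi p d ** Psi p e) j by rewrite -PsiM de.
  by move=> [z [k [Dz Ek ->]]]; rewrite mulA (RD y z).
rewrite -{1}(dj d1 Dd1) mulA dj //.
by rewrite -ed PsiM; exact: setmul_in.
Qed.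

(** [d = e * loc x] is R-related to [e] and lies strictly below the idempotent [loc x]. By
    [left_zero_below], a left zero image of [d] is a singleton, hence also right zero, and R-related
    idempotents share this property. *)
Lemma not_Rmax_right_zero (e : S) : idem e -> ~ Rmax e -> right_zero (Psi p e).
Proof.
move=> ee /existsNP[x /not_implyP[xe nxe]].
have x0e : loc x * e = e by exact: mul_locl_inv.
have x0x0 : loc x * loc x = loc x by exact: loc_idem.
pose d := e * loc x.
have dd : idem d by rewrite /idem /d -mulA (mulA (loc x)) x0e mulA ee.
have ed : e * d = d by rewrite /d mulA ee.
have de : d * e = e by rewrite /d -mulA x0e ee.
have x0d : loc x * d = d by rewrite /d mulA x0e.
have dx0 : d * loc x = d by rewrite /d -mulA x0x0.
apply: (right_zero_Req ed de); case: (Psi_zero p dd) => // LD.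
move=> a b Da Db; rewrite LD //; apply: (left_zero_below _ _ _ _ _ LD Da Db) => //.
- exact: x0x0.
- exact: x0d.
- exact: dx0.
- move=> dx; apply: nxe; apply: (jle_trans (jle_loc x)); rewrite -dx.
  exact: jle_mull.
Qed.

End PsiTypes.

Definition Lmax (S : crsemigroup) (a : S) := forall x, a * x = a -> jle x a.

Lemma Rmax_op (S : crsemigroup) (a : S) : @Rmax (op S) a = Lmax a.
Proof. by apply/propext; split=> h x /h; rewrite jle_op. Qed.

(** * Dual statements, and the round trip through the inverse isomorphism *)

Section PsiTypesDual.
Variables (S T : crsemigroup) (p : power_iso S T).
Let q := power_iso_sym p.

Lemma not_Lmax_left_zero (e : S) : idem e -> ~ Lmax e -> left_zero (Psi p e).
Proof.
move=> ee; rewrite -Rmax_op => /(@not_Rmax_right_zero _ _ (power_iso_op p) e ee) h a b Ea Eb.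
exact: h.
Qed.

Lemma left_zero_Leq (e d : S) : e * d = e -> d * e = d ->
  left_zero (Psi p d) -> left_zero (Psi p e).
Proof.
move=> ed de LD a b Ea Eb.
apply: (@right_zero_Req _ _ (power_iso_op p) e d de ed _ b a Eb Ea).
by move=> c f Dc Df; exact: LD.
Qed.

Lemma Psi_in (a b : S) x y : Psi p a x -> Psi p b y -> Psi p (a * b) (x * y).
Proof. by move=> ? ?; rewrite PsiM; exact: setmul_in. Qed.

Lemma Psi_ex a b x : Psi p (a * b) x ->
  exists y z, [/\ Psi p a y, Psi p b z & x = y * z].
Proof. by rewrite PsiM. Qed.

Lemma Psi_jle_same (b : S) x y : Psi p b x -> Psi p b y -> jle x y.
Proof.
move=> bx bY; have [c ic] := Psi_n0 p (inv b).
have := bx; rewrite -{1}(locl b) => /Psi_ex[k [z [Ek bz ->]]].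
apply: jle_trans (jle_mull _ _) _.
apply: (@jle_trans _ (y * c)); last exact: jle_mull.
apply: (zero_jle (Psi_zero p (loc_idem b)) Ek).
exact: Psi_in.
Qed.

Lemma jle_Psi (a b : S) x y : jle a b -> Psi p a x -> Psi p b y -> jle x y.
Proof.
move=> [u [v ->]] /Psi_ex[_ [z [/Psi_ex[w [y' [_ by' ->]]] _ ->]]] bY.
apply: jle_trans (jle_mull _ _) _; apply: jle_trans (jle_mulr _ _) _.
exact: Psi_jle_same by' bY.
Qed.

Lemma PsiK f : bwd p [set f] = Psi q f. Proof. by []. Qed.

(** The equations [{f} E = {f}] and [E {f} = E] pull back through [p], so the round trip stays in
    the L-class of [e]. *)
Lemma Psi_sym_left (e : S) f w : idem e -> left_zero (Psi p e) -> Psi p e f -> Psi q f w ->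
  w * e = w /\ e * w = e.
Proof.
move=> ee LE Ef fw.
have h1 : [set f] ** Psi p e = [set f].
  apply/seteqP; split=> [x /setmul1l[y Ey ->]|x ->]; first by rewrite LE.
  by apply/setmul1l; exists f; rewrite ?LE.
have h2 : Psi p e ** [set f] = Psi p e.
  apply/seteqP; split=> [x /setmul1r[y Ey ->]|x Ex]; first by rewrite LE.
  by apply/setmul1r; exists x; rewrite ?LE.
move/(congr1 (bwd p)): h1; move/(congr1 (bwd p)): h2.
rewrite !bwdM !fwdK PsiK => h2 h1; split.
  by have := fw; rewrite -{1}h1 => /setmul1r[v _ ->]; rewrite -mulA ee.
have : ([set e] ** Psi q f) (e * w) by exact: setmul_in.
by rewrite h2.
Qed.

End PsiTypesDual.

Section PsiInverse.
Variables (S T : crsemigroup) (p : power_iso S T).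
Let q := power_iso_sym p.

Lemma Psi_sym_right (e : S) f w : idem e -> right_zero (Psi p e) -> Psi p e f -> Psi q f w ->
  e * w = w /\ w * e = e.
Proof.
move=> ee RE Ef fw; apply: (@Psi_sym_left _ _ (power_iso_op p) e f w ee _ Ef fw).
by move=> a b Ea Eb; exact: RE.
Qed.

Lemma Psi_idem (e : S) f : idem e -> Psi p e f -> idem f.
Proof. by move=> /(Psi_zero p) [h|h] Ef; rewrite /idem h. Qed.

Lemma Psi_sym_jle (a : S) x w : Psi p a x -> Psi q x w -> jle a w /\ jle w a.
Proof.
have idem_case (e : S) f v : idem e -> Psi p e f -> Psi q f v -> jle e v /\ jle v e.
  move=> ee Ef fv; case: (Psi_zero p ee) => h.
    have [ve ev] := Psi_sym_left ee h Ef fv.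
    by split; [rewrite -ev|rewrite -ve]; exact: jle_mulr.
  have [ve ev] := Psi_sym_right ee h Ef fv.
  by split; [rewrite -ev|rewrite -ve]; exact: jle_mull.
move=> ax xw; have [f Ef] := Psi_n0 p (loc a); have [v fv] := Psi_n0 q f.
have [h1 h2] := idem_case _ _ _ (loc_idem a) Ef fv.
have xf : jle x f := jle_Psi (jle_loc a) ax Ef.
have fx : jle f x := jle_Psi (loc_jle a) Ef ax.
have wv : jle w v := @jle_Psi _ _ q _ _ _ _ xf xw fv.
have vw : jle v w := @jle_Psi _ _ q _ _ _ _ fx fv xw.
split; first exact: jle_trans (jle_loc a) (jle_trans h1 vw).
exact: jle_trans wv (jle_trans h2 (loc_jle a)).
Qed.

End PsiInverse.

(** * Constancy of products over a left zero image *)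

Section Components.
Variables (S T : crsemigroup) (p : power_iso S T).
Let q := power_iso_sym p.

Lemma Psi_jle (a b : S) x y : Psi p a x -> Psi p b y -> jle x y -> jle a b.
Proof.
move=> ax bY xy; have [w xw] := Psi_n0 q x; have [v yv] := Psi_n0 q y.
have [aw _] := Psi_sym_jle ax xw; have [_ vb] := Psi_sym_jle bY yv.
exact: jle_trans aw (jle_trans (@jle_Psi _ _ q _ _ _ _ xy xw yv) vb).
Qed.

Lemma right_zero_Psi_Req (a : S) v w : right_zero (Psi p (loc a)) ->
  Psi p a v -> Psi p a w -> Req v w.
Proof.
move=> RD; suff h v' w' : Psi p a v' -> Psi p a w' -> loc v' * w' = w'.
  by move=> av aw; split; exact: h.
move=> av; rewrite -{1}(locl a) => /Psi_ex[d [u [Dd au ->]]].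
have [c ic] := Psi_n0 p (inv a).
have Dvc : Psi p (loc a) (v' * c) by exact: Psi_in.
by rewrite -(RD _ _ Dvc Dd) !mulA locl.
Qed.

(** Counterpart of [right_zero_Psi_Req]: in the right zero case [Psi p a] stays inside one R-class,
    in the left zero case it meets each R-class at most once. *)
Lemma left_zero_Psi_Req (a : S) v w : left_zero (Psi p (loc a)) ->
  Psi p a v -> Psi p a w -> Req v w -> v = w.
Proof.
move=> LD av aw [vw _]; have [c ic] := Psi_n0 p (inv a).
have cv : Psi p (loc a) (c * v) by rewrite /loc mulC_inv; exact: Psi_in.
have vc : Psi p (loc a) (v * c) by exact: Psi_in.
have wc : Psi p (loc a) (w * c) by exact: Psi_in.
have fix_cv u : Psi p a u -> u * (c * v) = u.
  rewrite -{1}(locr a) => /Psi_ex[y [k [_ Dk ->]]].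
  by rewrite -mulA (LD k).
have vcw : v * c * w = w.
  by rewrite -vw mulA (mul_locl (_ : v * c * v = v)) // -mulA fix_cv.
have vcwc : v * c = w * c by rewrite -(LD _ _ vc wc) mulA vcw.
by rewrite -(fix_cv v av) mulA vcwc -mulA fix_cv.
Qed.

Section LeftZero.
Variable e : S.
Hypotheses (ee : idem e) (LE : left_zero (Psi p e)).
Let E := Psi p e.

(** Both products lie in [Psi p (s * e)], and the image of [d] is left zero, so they need only be
    R-related. If [s] is below [e], both are R-related to [y]; if not, [d] is not R-maximal and its
    image is right zero too. *)
Let mulr_const (s : S) y k l : Psi p s y -> E k -> E l -> y * k = y * l.
Proof.
move=> sy Ek El; pose d := loc (s * e).
have dd : idem d by exact: loc_idem.
have de : d * e = d by apply: mul_locr; rewrite -mulA ee.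
have LD : left_zero (Psi p d).
  have [Ld|/not_Lmax_left_zero] := pselect (Lmax d); last exact.
  apply: (@left_zero_Leq _ _ p d e) => //.
  by have := jle_loc_mulr (Ld _ de); rewrite de loc_id.
have yk : Psi p (s * e) (y * k) by exact: Psi_in.
have yl : Psi p (s * e) (y * l) by exact: Psi_in.
apply: (left_zero_Psi_Req LD yk yl).
have [se|nse] := pselect (jle s e).
  apply: (@Req_trans _ y); first apply: Req_sym.
    by apply: Req_mul; exact: jle_Psi se sy Ek.
  by apply: Req_mul; exact: jle_Psi se sy El.
apply: (right_zero_Psi_Req _ yk yl); apply: not_Rmax_right_zero => // Rd.
apply: nse; apply: (jle_trans (jle_loc s)); apply: (@jle_trans _ d); last first.
  by rewrite -de; exact: jle_mulr.
by apply: Rd; rewrite /d; apply: mul_locl; exact: loc_mull.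
Qed.

Let mull_const (t : S) y k l : ~ jle e t -> Psi p t y -> E k -> E l -> k * y = l * y.
Proof.
move=> net ty Ek El; pose d := loc (e * t).
have ed : e * d = d by apply: mul_locl; rewrite mulA ee.
have RD : right_zero (Psi p d).
  apply: not_Rmax_right_zero; first exact: loc_idem.
  move=> Rd; apply: net; apply: (jle_trans (Rd _ ed)).
  exact: jle_trans (loc_jle _) (jle_mulr _ _).
have ky : Psi p (e * t) (k * y) by exact: Psi_in.
have ly : Psi p (e * t) (l * y) by exact: Psi_in.
have [h _] := right_zero_Psi_Req RD ky ly.
have kky : k * (k * y) = k * y by rewrite mulA (LE Ek Ek).
by rewrite -[RHS]h -(mul_locl kky) -[RHS]mulA h mulA (LE Ek El).
Qed.

Lemma left_zero_sym_mulr k w : E k -> Psi q k w -> forall s, s * w = s * e.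
Proof.
move=> Ek kw s.
have h : Psi p s ** [set k] = Psi p (s * e).
  rewrite PsiM; apply/seteqP; split=> [x /setmul1r[y sy ->]|_ [y [l [sy El ->]]]].
    exact: setmul_in.
  by apply/setmul1r; exists y => //; exact: (mulr_const sy El Ek).
have : ([set s] ** Psi q k) (s * w) by exact: setmul_in.
suff -> : [set s] ** Psi q k = [set s * e] by [].
by apply: (@fwd_inj _ _ p); rewrite fwdM bwdK.
Qed.

Lemma left_zero_sym_mull k w : E k -> Psi q k w ->
  forall t, ~ jle e t -> w * t = e * t.
Proof.
move=> Ek kw t net.
have h : [set k] ** Psi p t = Psi p (e * t).
  rewrite PsiM; apply/seteqP; split=> [x /setmul1l[y sy ->]|_ [l [y [El ty ->]]]].
    exact: setmul_in.
  by apply/setmul1l; exists y => //; exact: (mull_const net ty El Ek).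
have : (Psi q k ** [set t]) (w * t) by exact: setmul_in.
suff -> : Psi q k ** [set t] = [set e * t] by [].
by apply: (@fwd_inj _ _ p); rewrite fwdM bwdK.
Qed.

(** [mulr_const] reaches only factors in the image of a singleton. An arbitrary [s] is reached
    through its preimage [Psi q s], on which [k] acts like [e]. *)
Lemma left_zero_mulr_const k l s : E k -> E l -> s * k = s * l.
Proof.
move=> Ek El; have [w kw] := Psi_n0 q k.
have h : Psi q s ** Psi q k = Psi q s ** [set e].
  apply/seteqP; split=> [_ [a [b [sa kb ->]]]|_ [a [b [sa -> ->]]]].
    by rewrite (left_zero_sym_mulr Ek kb); exact: setmul_in.
  by rewrite -(left_zero_sym_mulr Ek kw); exact: setmul_in.
move/(congr1 (fwd p)): h; rewrite !fwdM !bwdK setmul1 => h.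
have : ([set s] ** fwd p [set e]) (s * l) by exact: setmul_in.
by rewrite -h.
Qed.

Lemma left_zero_mull_const k l t : E k -> E l -> ~ jle k t -> k * t = l * t.
Proof.
move=> Ek El nkt; have [w kw] := Psi_n0 q k.
have net x : Psi q t x -> ~ jle e x.
  move=> tx ex; have [y xy] := Psi_n0 p x.
  have [_ yt] := Psi_sym_jle tx (xy : Psi (power_iso_sym q) x y).
  exact: nkt (jle_trans (jle_Psi ex Ek xy) yt).
have h : Psi q k ** Psi q t = [set e] ** Psi q t.
  apply/seteqP; split=> [_ [a [b [ka tb ->]]]|_ [a [b [-> tb ->]]]].
    by rewrite (left_zero_sym_mull Ek ka) ?net //; [exact: setmul_in|exact: net].
  by rewrite -(left_zero_sym_mull Ek kw (net _ tb)); exact: setmul_in.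
move/(congr1 (fwd p)): h; rewrite !fwdM !bwdK setmul1 => h.
have : (fwd p [set e] ** [set t]) (l * t) by exact: setmul_in.
by rewrite -h.
Qed.

End LeftZero.

(** This carries R-maximality through [p]. As [d] is maximal on neither side, its image is a
    singleton [{d'}]. Were all of [fwd p A] R-maximal, [d'] would be a right identity on [fwd p X];
    then [X = A ** {d}], which puts [loc x] below [d]. *)
Lemma not_Rmax_fwd (A : set S) (e : S) : idem e -> A e ->
    (forall a, A a -> a * e = a) -> (forall a, A a -> e * a = e) -> ~ Rmax e ->
  exists2 x, fwd p A x & ~ Rmax x.
Proof.
move=> ee Ae Ae' eA /existsNP[x /not_implyP[xe nxe]].
have x0e : loc x * e = e by exact: mul_locl_inv.
have x0x0 : loc x * loc x = loc x by exact: loc_idem.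
pose d := e * loc x.
have dd : d * d = d by rewrite /d -mulA (mulA (loc x)) x0e mulA ee.
have ed : e * d = d by rewrite /d mulA ee.
have x0d : loc x * d = d by rewrite /d mulA x0e.
have dx0 : d * loc x = d by rewrite /d -mulA x0x0.
have nx0d : ~ jle (loc x) d.
  move=> h; apply: nxe; apply: (jle_trans (jle_loc x)).
  by apply: (jle_trans h); exact: jle_mull.
have jed : jle e d by exists e, e; rewrite ed /d -mulA x0e ee.
have [d' Dd'] := Psi_n0 p d.
have Dd : Psi p d = [set d'].
  have LD : left_zero (Psi p d).
    by apply: not_Lmax_left_zero => // Ld; exact: nx0d (Ld _ dx0).
  have RD : right_zero (Psi p d).
    by apply: not_Rmax_right_zero => // Rd; exact: nx0d (Rd _ x0d).
  by apply/seteqP; split=> [y Dy|y ->//]; rewrite -(LD y d') // RD.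
pose X := [set loc x] `|` (A ** [set d]).
have Xd : X ** [set d] = A ** [set d].
  rewrite setmulUl setmul1 x0d -setmulA setmul1 dd; apply/seteqP; split=> [y [->|//]|y]; last by right.
  by rewrite -ed; exact: setmul_in.
have dX : [set d] ** X = [set d] ** (A ** [set d]).
  rewrite setmulUr setmul1 dx0; apply/seteqP; split=> [y [->|//]|y]; last by right.
  suff : ([set d] ** (A ** [set d])) (d * (e * d)) by rewrite ed dd.
  by do 2!apply: setmul_in => //.
apply: contrapT => nex.
have RA a : fwd p A a -> Rmax a.
  by move=> Aa; apply: contrapT => nR; apply: nex; exists a.
have AE : A ** [set e] = A.
  apply/seteqP; split=> [y /setmul1r[a Aa ->]|a Aa]; first by rewrite Ae'.
  by apply/setmul1r; exists a; rewrite ?Ae'.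
have Ad a : fwd p A a -> jle a d'.
  rewrite -AE fwdM => -[b [k [_ Ek ->]]].
  exact: jle_trans (jle_mulr _ _) (jle_Psi jed Ek Dd').
have Xd' : fwd p X ** [set d'] = fwd p A ** [set d'] by rewrite -Dd -!fwdM Xd.
have d'X : [set d'] ** fwd p X = [set d'] ** (fwd p A ** [set d']).
  by rewrite -Dd -!fwdM dX.
have yd' y : fwd p X y -> y * d' = y.
  move=> Xy.
  have : (fwd p X ** [set d']) (y * d') by exact: setmul_in.
  rewrite Xd' => /setmul1r[a Aa yda].
  have ya : jle y d'.
    apply: jle_trans (Ad _ Aa); apply: (jle_trans (jle_loc y)); apply: (RA _ Aa).
    have [_ h] := Req_mul (Ad _ Aa).
    by rewrite -h mulA; congr (_ * _); apply: mul_locl; rewrite -yda loc_mull.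
  have : ([set d'] ** fwd p X) (d' * y) by exact: setmul_in.
  rewrite d'X => /setmul1l[_ /setmul1r[b _ ->] d'y].
  have h : d' * y * d' = d' * y.
    have d'd' : d' * d' = d' by exact: (Psi_idem dd Dd').
    by rewrite d'y -!mulA d'd'.
  have e1 := jle_loc_mulr ya.
  by rewrite -[in LHS]e1 -mulA (mul_locr h) e1.
have XX : fwd p X = fwd p (A ** [set d]).
  rewrite fwdM -/(Psi p d) Dd -Xd'; apply/seteqP; split=> [y Xy|y /setmul1r[z Xz ->]].
    by apply/setmul1r; exists y; rewrite ?yd'.
  by rewrite yd'.
have : (A ** [set d]) (loc x) by rewrite -(fwd_inj XX); left.
by move=> /setmul1r[a _ xad]; apply: nx0d; rewrite xad; exact: jle_mulr.
Qed.

End Components.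

Lemma Rmax_Psi (S T : crsemigroup) (p : power_iso S T) (e : S) f :
  idem e -> Rmax e -> Psi p e f -> Rmax f.
Proof.
move=> ee Re Ef; apply: contrapT => nRf.
have ff : idem f := Psi_idem ee Ef.
case: (Psi_zero p ee) => h.
  have [||w] := @not_Rmax_fwd _ _ (power_iso_sym p) (Psi p e) f ff Ef _ _ nRf.
  - by move=> a Ea; exact: h.
  - by move=> a Ea; exact: h.
  - by rewrite /= fwdK => -> /(_ Re).
have [||w fw] := @not_Rmax_fwd _ _ (power_iso_sym p) [set f] f ff erefl _ _ nRf.
- by move=> a ->.
- by move=> a ->.
have [ew we] := Psi_sym_right ee h Ef fw.
apply; apply: (Rmax_Req _ Re); split; first by rewrite loc_id.
by rewrite mul_locl_inv.
Qed.

(** * Twins *)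

Section Twins.
Variable S : crsemigroup.
Implicit Types a b c d e s t x : S.

(* Exchanging the R-classes of two distinct twins, within their L-classes, gives
   an automorphism of [S]. *)
Definition twin a b := a = b \/
  [/\ Rmax a, Rmax b, forall s, s * a = s * b & forall t, ~ jle a t -> a * t = b * t].

Lemma twin_refl a : twin a a. Proof. by left. Qed.

Lemma twin_mull a b s : twin a b -> s * a = s * b.
Proof. by move=> [->|[]]. Qed.

Lemma twin_mulr_low a b t : twin a b -> ~ jle a t -> a * t = b * t.
Proof. by move=> [->|[_ _ _ h] /h]. Qed.

Lemma twin_jle a b : twin a b -> jle a b.
Proof. by move=> ab; rewrite -(locl a) (twin_mull _ ab); exact: jle_mulr. Qed.

Lemma twin_Rmax a b : twin a b -> ~ Rmax a -> a = b.
Proof. by move=> [|[]]. Qed.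

Lemma twin_sym a b : twin a b -> twin b a.
Proof.
move=> ab; have := twin_jle ab; case: ab => [->|[Ra Rb st lt] jab]; [by left|right].
by split=> // t nbt; apply/esym/lt => at_; apply: nbt; apply: jle_trans at_;
  rewrite -(locl b) -st; exact: jle_mulr.
Qed.

Lemma twin_trans b a c : twin a b -> twin b c -> twin a c.
Proof.
move=> ab; have ba := twin_jle (twin_sym ab).
case: ab => [->//|[Ra Rb sab lab]] [<-|[_ Rc sbc lbc]]; right; split=> //.
- by move=> s; rewrite sab.
- move=> t nat_; rewrite lab // lbc // => bt; apply: nat_; apply: jle_trans bt.
  by rewrite -(locl a) sab; exact: jle_mulr.
Qed.

Lemma twin_idem e f : idem e -> twin e f -> idem f.
Proof.
move=> ee ef; rewrite /idem -(twin_mull _ ef) -{1}(locl f) -{1}(twin_mull _ ef) -mulA ee.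
by rewrite (twin_mull _ ef) locl.
Qed.

Lemma twin_mulr a b t : twin a b -> twin (a * t) (b * t).
Proof.
move=> ab; have [at_|nat_] := pselect (jle a t); last first.
  by left; exact: twin_mulr_low.
have bt : jle b t by apply: jle_trans at_; apply/twin_jle/twin_sym.
case: (ab) => [->|[Ra Rb sab lab]]; [by left|right].
split.
- exact: Rmax_Req (Req_mul at_) Ra.
- exact: Rmax_Req (Req_mul bt) Rb.
- by move=> s; rewrite !mulA sab.
- move=> u nu; rewrite -!mulA lab // => atu; apply: nu.
  apply: jle_trans (jle_mull _ _) _; apply: (jle_trans atu); exact: jle_mulr.
Qed.

Lemma twin_Req e f : idem e -> twin e f -> Req e f -> e = f.
Proof.
move=> ee ef [h _]; rewrite loc_id // in h.
by rewrite -h -(twin_mull _ ef) ee.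
Qed.

(* The R-classes of [a] and [b] correspond to each other under twinning. *)
Definition rtwin a b := exists2 c, twin a c & Req c b.

Lemma Req_rtwin a b : Req a b -> rtwin a b.
Proof. by exists a => //; exact: twin_refl. Qed.

Lemma twin_rtwin a b : twin a b -> rtwin a b.
Proof. by exists b => //; exact: Req_refl. Qed.

Lemma Req_twin c b d : Req c b -> twin b d -> exists2 c', twin c c' & Req c' d.
Proof.
move=> cb bd; pose z := inv b * c.
have bz : b * z = c by rewrite /z mulA cb.2.
exists (d * z); first by rewrite -bz; exact: twin_mulr.
apply: Req_sym; apply: Req_mul; apply: (@jle_trans _ b).
  by apply/twin_jle/twin_sym.
apply: jle_mul; last exact/Req_jle/Req_sym.
by exists b, b; rewrite -/(loc b) locl.
Qed.

Lemma rtwin_sym a b : rtwin a b -> rtwin b a.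
Proof. by move=> [c ac cb]; apply: Req_twin (Req_sym cb) (twin_sym ac). Qed.

Lemma rtwin_trans b a c : rtwin a b -> rtwin b c -> rtwin a c.
Proof.
move=> [x ax xb] [y bY yc]; have [z xz zy] := Req_twin xb bY.
by exists z; [exact: twin_trans ax xz|exact: Req_trans zy yc].
Qed.

Lemma rtwin_jle a b : rtwin a b -> jle a b.
Proof. by move=> [c ac cb]; exact: jle_trans (twin_jle ac) (Req_jle cb). Qed.

Lemma rtwin_Rmax a b : rtwin a b -> Rmax a -> Rmax b.
Proof. by move=> [c [->|[_ Rc _ _]] cb] Ra; apply: (Rmax_Req cb). Qed.

End Twins.

(** * The isomorphism on twin classes *)

Section TwinsPsi.
Variables (S T : crsemigroup) (p : power_iso S T).
Let q := power_iso_sym p.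

Lemma Psi_mul_same (e : S) k f s : idem e -> Psi p e k -> Psi p e f -> s * (k * f) = s * f.
Proof.
move=> ee Ek Ef; case: (Psi_zero p ee) => h; last by rewrite (h _ _ Ek Ef).
by rewrite (h _ _ Ek Ef); exact: left_zero_mulr_const ee h _ _ _ Ek Ef.
Qed.

Lemma Psi_mul_low (e : S) k f t : idem e -> Psi p e k -> Psi p e f -> ~ jle f t ->
  k * f * t = f * t.
Proof.
move=> ee Ek Ef nft; case: (Psi_zero p ee) => h; last by rewrite (h _ _ Ek Ef).
rewrite (h _ _ Ek Ef); apply: (left_zero_mull_const ee h Ek Ef) => kt.
by apply: nft; exact: jle_trans (Psi_jle_same Ef Ek) kt.
Qed.

Lemma Psi_mul3 (e : S) f : idem e -> Psi p e f ->
  Psi p e ** [set f] ** Psi p e = Psi p e.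
Proof.
move=> ee Ef; apply/seteqP; split=> [_ [_ [l [/setmul1r[k Ek ->] El ->]]]|k Ek].
  by case: (Psi_zero p ee) => h; [rewrite (h _ _ Ek Ef) (h _ _ Ek El)|rewrite (h _ _ Ek Ef) (h _ _ Ef El)].
case: (Psi_zero p ee) => h.
  by rewrite -(h _ _ Ek Ef) -{1}(h _ _ Ek Ef); do 2?apply: setmul_in.
suff : (Psi p e ** [set f] ** Psi p e) (f * f * k) by rewrite (h _ _ Ef Ef) (h _ _ Ef Ek).
by do 2?apply: setmul_in.
Qed.

Lemma fwd_mem (B : set S) x : fwd p B x -> B !=set0.
Proof.
move=> Bx; apply/set0P/eqP => B0.
by move: Bx; rewrite B0 fwd0.
Qed.

(** Right multiplication by [f] normalises the image of [B] into the twin class of [f], giving the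
    map on subsets needed for the cardinality argument. Equations such as
    [Psi q s ** B = Psi q s ** {e}] express twinning through sets and so pass through [p]. *)
Lemma twin_fwd (e : S) (B : set S) f g : idem e -> B `<=` twin e ->
  Psi p e f -> fwd p B g -> twin f (g * f).
Proof.
move=> ee sB Ef Bg; have ff := Psi_idem ee Ef.
have [b0 Bb0] := fwd_mem Bg.
have [Re|nRe] := pselect (Rmax e); last first.
  left; have Be : B = [set e].
    apply/seteqP; split=> [b /sB /twin_Rmax-> //|_ ->].
    by have := Bb0; rewrite (twin_Rmax (sB _ Bb0) nRe).
  rewrite Be in Bg; have RE : right_zero (Psi p e) by exact: not_Rmax_right_zero.
  by rewrite (RE _ _ Bg Ef).
have RB b : B b -> Rmax b by move=> /sB/twin_rtwin/rtwin_Rmax; apply.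
have eB : [set e] ** B = [set e].
  apply/seteqP; split=> [x /setmul1l[b /sB/twin_sym be ->]|x ->]; first by rewrite (twin_mull _ be) ee.
  by apply/setmul1l; exists b0 => //; rewrite (twin_mull _ (twin_sym (sB _ Bb0))) ee.
have fgf h : fwd p B h -> f * h * f = f.
  move=> Bh; have Efh : Psi p e (f * h).
    by rewrite /Psi -eB fwdM; exact: setmul_in.
  case: (Psi_zero p ee) => z; last by rewrite (z _ _ Efh Ef).
  have fh : f * h = f by rewrite -{1}ff -mulA (z _ _ Ef Efh).
  by rewrite fh.
have hf h h' : fwd p B h' -> h * f * (h' * f) = h * f.
  by move=> Bh'; rewrite -mulA (mulA f h' f) fgf.
right; split.
- exact: Rmax_Psi ee Re Ef.
- apply: contrapT => nR; have Agf : (fwd p B ** [set f]) (g * f) by exact: setmul_in.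
  have [|||x] := @not_Rmax_fwd _ _ q _ (g * f) _ Agf _ _ nR.
  + exact: hf.
  + by move=> _ /setmul1r[h Bh ->]; exact: hf.
  + by move=> _ /setmul1r[h Bh ->]; exact: hf.
  rewrite /= bwdM fwdK => -[b [w [Bb fw ->]]]; apply.
  apply: Rmax_Req (RB _ Bb); apply: Req_mul.
  apply: (@jle_trans _ e); first by apply/twin_jle/twin_sym/sB.
  by have [] := Psi_sym_jle Ef fw.
- move=> s; have h : Psi q s ** B = Psi q s ** [set e].
    apply/seteqP; split=> [_ [a [b [sa Bb ->]]]|_ /setmul1r[a sa ->]].
      by rewrite -(twin_mull _ (sB _ Bb)); exact: setmul_in.
    by rewrite (twin_mull _ (sB _ Bb0)); exact: setmul_in.
  move/(congr1 (fwd p)): h; rewrite !fwdM !bwdK => h.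
  have : ([set s] ** fwd p B) (s * g) by exact: setmul_in.
  rewrite h => /setmul1l[k Ek sg]; rewrite mulA sg -mulA.
  by rewrite (Psi_mul_same _ ee Ek Ef).
- move=> t nft.
  have net w x : Psi q f w -> Psi q t x -> ~ jle e (w * x).
    move=> _ tx ewx; apply: nft.
    have [y xy] := Psi_n0 p x.
    have [_ yt] := @Psi_sym_jle _ _ q t x y tx xy.
    by apply: jle_trans yt; apply: jle_Psi (jle_trans ewx (jle_mulr _ _)) Ef xy.
  have h : B ** (Psi q f ** Psi q t) = [set e] ** (Psi q f ** Psi q t).
    apply/seteqP; split=> [_ [b [_ [Bb [w [x [fw tx ->]]] ->]]]|_ /setmul1l[_ [w [x [fw tx ->]]] ->]].
      rewrite -(twin_mulr_low (sB _ Bb) (net _ _ fw tx)).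
      by do 2?apply: setmul_in.
    rewrite (twin_mulr_low (sB _ Bb0) (net _ _ fw tx)).
    by do 2?apply: setmul_in.
  move/(congr1 (fwd p)): h; rewrite !fwdM !bwdK setmul1 => h.
  have : (fwd p B ** [set f * t]) (g * (f * t)) by exact: setmul_in.
  by rewrite h => /setmul1r[k Ek gE]; rewrite -mulA gE mulA (Psi_mul_low ee Ek Ef nft).
Qed.

Lemma fwd_twin_inj (e : S) (B : set S) f : idem e -> B `<=` twin e -> Psi p e f ->
  bwd p (fwd p B ** [set f]) ** [set e] = B.
Proof.
move=> ee sB Ef; apply: (@fwd_inj _ _ p); rewrite fwdM bwdK.
have Be : B ** [set e] = B.
  have be b : B b -> b * e = b.
    by move=> /sB eb; rewrite (twin_mull _ eb) (twin_idem ee eb).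
  apply/seteqP; split=> [x /setmul1r[b Bb ->]|b Bb]; first by rewrite be.
  by apply/setmul1r; exists b; rewrite ?be.
rewrite -{1}Be fwdM -[RHS](congr1 (fwd p) Be) fwdM -/(Psi p e).
by rewrite -!setmulA (setmulA (Psi p e)) Psi_mul3.
Qed.

(** By [same], all elements of the image of an idempotent lie in one [rtwin] class, so [p] acts on
    these classes as a single-valued map. *)
Lemma Psi_rtwin (e d : S) f g : idem e -> idem d -> rtwin e d -> Psi p e f -> Psi p d g ->
  rtwin f g.
Proof.
move=> ee dd [c ec cd] Ef Dg.
have [h Ch] := Psi_n0 p c; have cc := twin_idem ee ec.
have same (x : S) k l : idem x -> Psi p x k -> Psi p x l -> rtwin k l.
  move=> xx xk xl; have [Rx|nRx] := pselect (Rmax x); last first.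
    apply: Req_rtwin; apply: (@right_zero_Psi_Req _ _ p x) => //.
    by rewrite loc_id //; exact: not_Rmax_right_zero.
  case: (Psi_zero p xx) => h'.
    apply: twin_rtwin; right; split.
    - exact: Rmax_Psi xx Rx xk.
    - exact: Rmax_Psi xx Rx xl.
    - by move=> s; exact: left_zero_mulr_const xx h' _ _ _ xk xl.
    - by move=> t; exact: left_zero_mull_const xx h' _ _ _ xk xl.
  apply: Req_rtwin; apply: (@right_zero_Psi_Req _ _ p x) => //.
  by rewrite loc_id.
apply: (@rtwin_trans _ h).
  have sc : [set c] `<=` twin e by move=> ? ->.
  exists (h * f); first exact: twin_fwd ee sc Ef Ch.
  apply: Req_sym; apply: Req_mul.
  by apply: jle_Psi (twin_jle (twin_sym ec)) Ch Ef.
have cdd : c * d = d by have [] := cd; rewrite loc_id.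
have := Dg; rewrite -cdd => /Psi_ex[k [l [Ck Dl ->]]].
apply: rtwin_trans (same _ _ _ cc Ch Ck) _; apply: Req_rtwin; apply: Req_mul.
exact: jle_Psi (Req_jle cd) Ck Dl.
Qed.

Lemma Psi_sym_rtwin (e : S) f w : idem e -> Psi p e f -> Psi q f w -> rtwin w e.
Proof.
move=> ee Ef fw; have [we ew] := Psi_sym_jle Ef fw.
have RZ : right_zero (Psi p e) -> rtwin w e.
  move=> h; have [h1 h2] := Psi_sym_right ee h Ef fw.
  by apply/Req_rtwin/Req_sym; split; [rewrite loc_id|exact: mul_locl_inv].
have [Re|nRe] := pselect (Rmax e); last by apply/RZ/not_Rmax_right_zero.
case: (Psi_zero p ee) => [LE|/RZ//].
have [h1 h2] := Psi_sym_left ee LE Ef fw.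
apply: twin_rtwin; right; split=> //.
- apply: contrapT => nRw.
  have [|||x] := @not_Rmax_fwd _ _ p (Psi q f) w _ fw _ _ nRw.
  + by rewrite /idem -{1}h1 -mulA h2 h1.
  + by move=> a fa; have [ae ea] := Psi_sym_left ee LE Ef fa; rewrite -{1}ae -mulA h2.
  + by move=> a fa; have [ae ea] := Psi_sym_left ee LE Ef fa; rewrite -{1}h1 -mulA ea.
  by rewrite /= bwdK => -> /(_ (Rmax_Psi ee Re Ef)).
- by move=> s; exact: left_zero_sym_mulr ee LE _ _ Ef fw s.
- move=> t nwt; apply: (left_zero_sym_mull ee LE Ef fw) => et.
  by apply: nwt; exact: jle_trans ew et.
Qed.

End TwinsPsi.

Lemma twin_bij (S T : crsemigroup) (p : power_iso S T) (e : S) f : GCH -> idem e -> Psi p e f ->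
  exists h : S -> T, [/\ forall x, twin e x -> twin f (h x),
    forall x y, twin e x -> twin e y -> h x = h y -> x = y &
    forall y, twin f y -> exists2 x, twin e x & h x = y].
Proof.
move=> gch ee Ef; pose q := power_iso_sym p; have ff := Psi_idem ee Ef.
have [w fw] := Psi_n0 q f; have ww := Psi_idem ff fw.
have [c wc ce] := Psi_sym_rtwin ee Ef fw; have cc := twin_idem ww wc.
have [ce1 ec1] : c * e = e /\ e * c = c by apply/Req_idem.
(* The way back lands in the twin class of [w], which is that of [c] and need not be that of [e].
   Right multiplication by [e] moves it there, and [jK] undoes this by multiplying with [c]. *)
pose i X := fwd p X ** [set f]; pose j Y := bwd p Y ** [set w] ** [set e].
have iP X : X `<=` twin e -> i X `<=` twin f.
  by move=> sX _ /setmul1r[g Xg ->]; exact: twin_fwd ee sX Ef Xg.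
have jP Y : Y `<=` twin f -> bwd p Y ** [set w] `<=` twin c.
  move=> sY _ /setmul1r[g Yg ->]; apply: twin_trans (twin_sym wc) _.
  exact: (@twin_fwd _ _ q f Y w g ff sY fw Yg).
have jK Y : Y `<=` twin f -> j Y ** [set c] = bwd p Y ** [set w].
  move=> /jP sY; rewrite /j -setmulA setmul1 ec1.
  have xc x : (bwd p Y ** [set w]) x -> x * c = x.
    by move=> /sY cx; rewrite (twin_mull _ cx) (twin_idem cc cx).
  apply/seteqP; split=> [x /setmul1r[y Yy ->]|x Yx]; first by rewrite xc.
  by apply/setmul1r; exists x; rewrite ?xc.
have [|||h [g hK gK]] := @GCH_subsets_bij S T (twin e) (twin f) i j gch iP.
- move=> X Y sX sY XY; rewrite -(fwd_twin_inj ee sX Ef) -(fwd_twin_inj ee sY Ef).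
  by rewrite -/(i X) XY.
- move=> Y sY _ /setmul1r[x /(jP _ sY) cx ->].
  by rewrite -{1}ce1; exact: twin_mulr.
- move=> X Y sX sY XY; rewrite -(@fwd_twin_inj _ _ q f X w ff sX fw).
  rewrite -(@fwd_twin_inj _ _ q f Y w ff sY fw) /=.
  by rewrite -(jK _ sX) -(jK _ sY) XY.
pose h' x := if pselect (twin e x) is left ex then sval (h (exist _ x ex)) else f.
have h'E x (ex : twin e x) : h' x = sval (h (exist _ x ex)).
  rewrite /h'; case: pselect => [ex'|//].
  by congr (sval (h (exist _ x _))); exact: Prop_irrelevance.
exists h'; split=> [x ex|x y ex ey|y fy].
- by rewrite h'E; exact: (svalP (h _)).
- rewrite !h'E => hxy; have /(can_inj hK) : h (exist _ x ex) = h (exist _ y ey).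
    by apply: eq_sig_hprop => // ? ? ?; exact: Prop_irrelevance.
  by case.
- case gy : (g (exist _ y fy)) => [x ex]; exists x => //.
  by rewrite h'E -gy gK.
Qed.

(** * Matching the R-classes of the two semigroups *)

Section Representatives.
Variable S : crsemigroup.

(** The predicate is the same for all members of an [rtwin] class, so they share one choice. The
    second branch is never taken, because of [loc a]. *)
Definition rep (a : S) : S :=
  if pselect (exists x, idem x /\ rtwin a x) is left h then sval (cid h) else a.

Lemma repP a : idem (rep a) /\ rtwin a (rep a).
Proof.
rewrite /rep; case: pselect => [h|[]]; first exact: (svalP (cid h)).
by exists (loc a); split; [exact: loc_idem|exact/Req_rtwin/Req_loc].
Qed.

Lemma rep_rtwin a b : rtwin a b -> rep a = rep b.
Proof.
move=> ab; rewrite /rep.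
have -> : (fun x => idem x /\ rtwin a x) = (fun x => idem x /\ rtwin b x).
  apply/funext => x; apply/propext; split=> -[xx h]; split=> //.
    exact: rtwin_trans (rtwin_sym ab) h.
  exact: rtwin_trans ab h.
case: pselect => // -[]; exists (loc b).
by split; [exact: loc_idem|exact/Req_rtwin/Req_loc].
Qed.

End Representatives.

(* [beta] matches the R-classes of [S] with those of [T], compatibly with [p]
   up to twins. *)
Definition rclass_match (S T : crsemigroup) (p : power_iso S T) (beta : S -> T) :=
  [/\ forall a b, idem a -> idem b -> Req a b -> beta a = beta b,
      forall a b, idem a -> idem b -> Req (beta a) (beta b) -> Req a b,
      forall f, idem f -> exists2 e, idem e & Req (beta e) f,
      forall e k, idem e -> Psi p e k -> twin (beta e * k) k &
      forall e k, idem e -> Psi p e k -> jle (beta e) k /\ jle k (beta e)].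

(** Each [rtwin] class gets one idempotent [rep a] and one bijection of twin classes. The R-class of
    [a] contains exactly one twin [l a] of [rep a], and [beta a] is the partner of [l a]. *)
Lemma exists_rclass_match (S T : crsemigroup) (p : power_iso S T) : GCH ->
  exists beta, rclass_match p beta.
Proof.
move=> gch; pose q := power_iso_sym p.
have /choice[F FP] : forall e : S, exists fh : T * (S -> T), idem e ->
    Psi p e fh.1 /\ [/\ forall x, twin e x -> twin fh.1 (fh.2 x),
    forall x y, twin e x -> twin e y -> fh.2 x = fh.2 y -> x = y &
    forall y, twin fh.1 y -> exists2 x, twin e x & fh.2 x = y].
  move=> e; have [f Ef] := Psi_n0 p e.
  have [ee|nee] := pselect (idem e); last by exists (f, fun=> f).
  by have [h hP] := twin_bij gch ee Ef; exists (f, h).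
have /choice[l lP] : forall a : S, exists l, twin (rep a) l /\ Req l a.
  by move=> a; have [_ /rtwin_sym[l ? ?]] := repP a; exists l.
have FR a := FP _ (repP a).1.
pose f0 a := (F (rep a)).1; pose beta a := (F (rep a)).2 (l a).
have f0P a : Psi p (rep a) (f0 a) by have [] := FR a.
have f0_idem a : idem (f0 a) := Psi_idem (repP a).1 (f0P a).
have betaP a : twin (f0 a) (beta a) by have [_ [h _ _]] := FR a; apply: h; have [] := lP a.
have beta_idem a : idem (beta a) := twin_idem (f0_idem a) (betaP a).
have l_idem a : idem (l a) := twin_idem (repP a).1 (lP a).1.
have l_eq a b : rep a = rep b -> Req a b -> l a = l b.
  move=> ab Rab; apply: twin_Req => //.
    by apply: twin_trans (twin_sym (lP a).1) _; rewrite ab; exact: (lP b).1.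
  exact: Req_trans (lP a).2 (Req_trans Rab (Req_sym (lP b).2)).
have f0_rtwin a k : idem a -> Psi p a k -> rtwin (f0 a) k.
  move=> aa ak; apply: (Psi_rtwin (repP a).1 aa _ (f0P a) ak).
  exact: rtwin_sym (repP a).2.
exists beta; split.
- move=> a b aa bb ab; have repE := rep_rtwin (Req_rtwin ab).
  by rewrite /beta repE (l_eq _ _ repE ab).
- move=> a b aa bb bab.
  have f0ab : rtwin (f0 a) (f0 b).
    apply: rtwin_trans (twin_rtwin (betaP a)) _; apply: rtwin_trans (Req_rtwin bab) _.
    exact/twin_rtwin/twin_sym.
  have [w aw] := Psi_n0 q (f0 a); have [v bv] := Psi_n0 q (f0 b).
  have wv : rtwin w v := @Psi_rtwin _ _ q _ _ _ _ (f0_idem a) (f0_idem b) f0ab aw bv.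
  have wa := Psi_sym_rtwin (repP a).1 (f0P a) aw.
  have vb := Psi_sym_rtwin (repP b).1 (f0P b) bv.
  have ab : rtwin a b.
    apply: rtwin_trans (repP a).2 _; apply: rtwin_trans (rtwin_sym wa) _.
    apply: rtwin_trans wv _; apply: rtwin_trans vb _; exact: rtwin_sym (repP b).2.
  have repE := rep_rtwin ab.
  have f0E : f0 a = f0 b by rewrite /f0 repE.
  have bE : beta a = beta b.
    apply: twin_Req => //; apply: twin_trans (twin_sym (betaP a)) _; rewrite f0E.
    exact: betaP.
  have lE : l a = l b.
    have [_ [_ h _]] := FR a; apply: h; first exact: (lP a).1.
      by rewrite repE; exact: (lP b).1.
    by move: bE; rewrite /beta repE.
  by apply: Req_trans (Req_sym (lP a).2) _; rewrite lE; exact: (lP b).2.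
- move=> f ff; have [w fw] := Psi_n0 q f; have ww := Psi_idem ff fw.
  have [g wg] := Psi_n0 p w.
  have gf : rtwin g f := @Psi_sym_rtwin _ _ q f w g ff fw wg.
  have [f1 f01 f1f] : rtwin (f0 w) f := rtwin_trans (f0_rtwin _ _ ww wg) gf.
  have [_ [_ _ h]] := FR w; have [x ex xf1] := h _ f01.
  have xx := twin_idem (repP w).1 ex.
  have repE : rep x = rep w.
    apply: rep_rtwin; apply: rtwin_trans (rtwin_sym (twin_rtwin ex)) _.
    exact: rtwin_sym (repP w).2.
  exists x => //; rewrite /beta repE (_ : l x = x) ?xf1 //.
  apply: twin_Req => //; last exact: (lP x).2.
  by apply: twin_trans (twin_sym (lP x).1) _; rewrite repE.
- move=> e k ee Ek; have [c fc ck] := f0_rtwin _ _ ee Ek.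
  have cc := twin_idem (f0_idem e) fc.
  have ckk : c * k = k by have [] := ck; rewrite loc_id.
  rewrite -{2}ckk; apply: twin_mulr; exact: twin_trans (twin_sym (betaP e)) fc.
- move=> e k ee Ek; have h := rtwin_trans (rtwin_sym (twin_rtwin (betaP e))) (f0_rtwin _ _ ee Ek).
  by split; apply: rtwin_jle => //; exact: rtwin_sym.
Qed.

Lemma twin_op_mulr (S : crsemigroup) (a b s : S) : @twin (op S) a b -> a * s = b * s.
Proof. exact: (@twin_mull (op S) a b s). Qed.

(** * The corrected map and its bijectivity *)

Section HalfTheta.
Variables (S T : crsemigroup) (p : power_iso S T) (beta : S -> T).
Hypothesis mb : rclass_match p beta.

Lemma Psi_locl a x : Psi p a x -> exists2 k, Psi p (loc a) k & k * x = x.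
Proof.
move=> ax; have := ax; rewrite -{1}(locl a) => /Psi_ex[k [y [Ek ay ->]]].
by exists k => //; rewrite mulA (Psi_idem (loc_idem a) Ek).
Qed.

Lemma match_twin a x : Psi p a x -> twin (beta (loc a) * x) x.
Proof.
move=> /Psi_locl[k Ek kx]; case: mb => _ _ _ h _.
by have := twin_mulr x (h _ _ (loc_idem a) Ek); rewrite -mulA kx.
Qed.

(** If [a] is below [b], then [a] and [a * b] are R-related and get the same [beta]. If not, [x * y]
    is not R-maximal, has no twin but itself, and both sides equal it. *)
Lemma match_mul a b x y : Psi p a x -> Psi p b y ->
  beta (loc a) * (x * y) = beta (loc (a * b)) * (x * y).
Proof.
move=> ax bY; have [ab|nab] := pselect (jle a b).
  case: mb => h _ _ _ _; congr (_ * _); apply: h; try exact: loc_idem.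
  apply: Req_trans (Req_sym (Req_loc a)) _; apply: Req_trans (Req_mul ab) _.
  exact: Req_loc.
have nxy : ~ jle x y by move=> xy; apply: nab; exact: Psi_jle ax bY xy.
rewrite mulA -(twin_mulr_low (twin_sym (match_twin ax)) nxy).
have tab := match_twin (Psi_in ax bY).
apply: (twin_Rmax (twin_sym tab)) => Rxy; apply: nxy.
apply: (jle_trans (jle_loc x)); apply: (@jle_trans _ (x * y)); last exact: jle_mulr.
by apply: Rxy; exact: loc_mull.
Qed.

(** [x = k * x] and [y = l * x] with [k], [l] in the left zero image of [loc a], which cannot be
    told apart from the left. This makes [theta] independent of the choice in [Psi p a]. *)
Lemma match_const a x y : left_zero (Psi p (loc a)) -> Psi p a x -> Psi p a y ->
  forall s, s * x = s * y.
Proof.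
move=> LE ax ay s; have [k Ek kx] := Psi_locl ax; have [l El ly] := Psi_locl ay.
have jk z m : Psi p (loc a) m -> Psi p a z -> jle m z.
  by move=> Em az; exact: jle_Psi (loc_jle a) Em az.
have aly : Psi p a (l * x) by rewrite -(locl a); exact: Psi_in.
have -> : y = l * x.
  apply: (left_zero_Psi_Req LE ay aly); rewrite -{1}ly.
  apply: (@Req_trans _ l); last exact: Req_mul (jk _ _ El ax).
  exact: Req_sym (Req_mul (jk _ _ El ay)).
rewrite -{1}kx !mulA; congr (_ * _).
exact: left_zero_mulr_const (loc_idem a) LE _ _ _ Ek El.
Qed.

End HalfTheta.

Section Theta.
Variables (S T : crsemigroup) (p : power_iso S T) (beta gamma : S -> T).
Hypotheses (mb : rclass_match p beta) (mg : rclass_match (power_iso_op p) gamma).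

(* The choice of [lift_Psi a] in [Psi p a] is immaterial, see [thetaE]. *)
Definition lift_Psi a : T := sval (cid (Psi_n0 p a)).
Definition theta a : T := beta (loc a) * lift_Psi a * gamma (loc a).

Let twin_gamma a x : Psi p a x -> @twin (op T) (x * gamma (loc a)) x.
Proof. by move=> ax; have := match_twin mg ax; rewrite loc_op. Qed.

Lemma thetaE a x : Psi p a x -> theta a = beta (loc a) * x * gamma (loc a).
Proof.
move=> ax; rewrite /theta; move: (svalP (cid (Psi_n0 p a))); rewrite -/(lift_Psi a) => ay.
case: (Psi_zero p (loc_idem a)) => h.
  by rewrite (match_const h ay ax).
rewrite -!mulA; congr (_ * _).
apply: (@match_const _ _ (power_iso_op p) a _ _ _ ay ax (gamma (loc a))).
by rewrite loc_op => u v Eu Ev; exact: h.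
Qed.

(** The inner factors [gamma (loc a)] and [beta (loc b)] only replace [x] and [y] by twins, seen
    from the side where twins agree, and so disappear; [match_mul] and its dual adjust the outer
    ones. *)
Lemma thetaM a b : theta (a * b) = theta a * theta b.
Proof.
have [x ax] := Psi_n0 p a; have [y bY] := Psi_n0 p b.
rewrite (thetaE ax) (thetaE bY) (thetaE (Psi_in ax bY)).
have e2 : x * y * gamma (loc b) = x * y * gamma (loc (a * b)).
  by have := match_mul mg bY ax; rewrite !loc_op.
have e3 : x * gamma (loc a) * (beta (loc b) * y) = x * y.
  by rewrite (twin_op_mulr _ (twin_gamma ax)) (twin_mull _ (match_twin mb bY)).
rewrite -(match_mul mb ax bY) -[LHS]mulA -e2.
rewrite -(mulA _ x (gamma _)) (mulA (_ * (x * _))) -(mulA _ (x * _)) e3.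
by rewrite -!mulA.
Qed.

Lemma theta_sandwich a x k l : Psi p a x -> Psi p (loc a) k -> Psi p (loc a) l ->
  k * theta a * l = k * x * l.
Proof.
move=> ax Ek El; rewrite (thetaE ax) !mulA -(mulA k) (twin_mull _ (match_twin mb ax)).
by rewrite -!mulA; congr (_ * _); rewrite mulA (twin_op_mulr _ (twin_gamma ax)).
Qed.

Lemma theta_Req a : Req (beta (loc a)) (theta a).
Proof.
have [x ax] := Psi_n0 p a; rewrite (thetaE ax) -mulA; apply: Req_mul.
have [k Ek] := Psi_n0 p (loc a); case: mb => _ _ _ _ h.
apply: jle_trans (h _ _ (loc_idem a) Ek).1 _.
apply: jle_trans (jle_Psi (loc_jle a) Ek ax) _.
by have := twin_jle (twin_sym (twin_gamma ax)); rewrite jle_op.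
Qed.

(** Sandwiching between elements of the image of [loc a] strips both corrections, so the value of
    [theta] determines [Psi p a]. *)
Lemma theta_inj_loc a b : loc a = loc b -> theta a = theta b -> a = b.
Proof.
have sub c d : loc c = loc d -> theta c = theta d -> Psi p c `<=` Psi p d.
  move=> cd tcd y; rewrite -{1}(locl c) -{2}(locr c) mulA.
  move=> /Psi_ex[_ [l [/Psi_ex[k [x [Ek cx ->]]] El ->]]].
  have [z dz] := Psi_n0 p d; rewrite -(theta_sandwich cx Ek El) tcd.
  rewrite cd in Ek El; rewrite (theta_sandwich dz Ek El).
  by rewrite -(locl d) -{2}(locr d) mulA; do 2?apply: Psi_in.
move=> ab tab; apply: (@Psi_inj _ _ p); apply/seteqP; split; exact: sub.
Qed.

End Theta.

Lemma Req_op_eq (S : crsemigroup) (e f : S) : idem e -> idem f ->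
  Req e f -> @Req (op S) e f -> e = f.
Proof.
move=> ee ff /(Req_idem ee ff)[ef _] /(@Req_idem (op S) e f ee ff)[_ h].
by rewrite -ef; exact/esym.
Qed.

Section ThetaBijective.
Variables (S T : crsemigroup) (p : power_iso S T) (beta gamma : S -> T).
Hypotheses (mb : rclass_match p beta) (mg : rclass_match (power_iso_op p) gamma).

Let theta := theta p beta gamma.

Let theta_Req_op a : @Req (op T) (gamma (loc a)) (theta a).
Proof.
have [x ax] := Psi_n0 p a; rewrite /theta (thetaE beta gamma ax).
apply: (@Req_mul (op T) (gamma (loc a)) (beta (loc a) * x)); rewrite jle_op.
have [k Ek] := Psi_n0 p (loc a); case: mg => _ _ _ _ h.
have [] := h _ _ (loc_idem a) Ek; rewrite !jle_op => gk _.
apply: (jle_trans gk); apply: jle_trans (jle_Psi (loc_jle a) Ek ax) _.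
exact: twin_jle (twin_sym (match_twin mb ax)).
Qed.

Lemma theta_inj : injective theta.
Proof.
move=> a b ab; apply: (theta_inj_loc mb mg _ ab).
case: mb => _ hb _ _ _; case: mg => _ hg _ _ _.
apply: Req_op_eq; [exact: loc_idem|exact: loc_idem| |].
  apply: hb; [exact: loc_idem|exact: loc_idem|].
  apply: Req_trans (theta_Req mb mg a) _; rewrite -/theta -/(theta a) ab.
  exact: Req_sym (theta_Req mb mg b).
apply: hg; [exact: (loc_idem a)|exact: (loc_idem b)|].
apply: (@Req_trans (op T) _ _ _ (theta_Req_op a)); rewrite ab.
exact: (@Req_sym (op T) _ _ (theta_Req_op b)).
Qed.

Lemma theta_surj c : exists a, theta a = c.
Proof.
pose f := loc c; have ff : idem f by exact: loc_idem.
have fc : f * c = c by exact: locl.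
have cf : c * f = c by exact: locr.
have fi : f * inv c = inv c by exact: loc_inv.
have ci : c * inv c = f by [].
have ic : inv c * c = f by rewrite -mulC_inv.
case: (mb) => bR _ bS bT bJ; case: (mg) => gR _ gS gT gJ.
have [e1 ee1 b1] := bS f ff.
have [e2 ee2 g2] : exists2 e : S, idem e & @Req (op T) (gamma e) f.
  exact: gS f ff.
have [k1 Ek1] := Psi_n0 p e1; have [k2 Ek2] := Psi_n0 p e2.
have [bk1 kb1] := bJ _ _ ee1 Ek1.
have [gk2 kg2] := gJ _ _ ee2 Ek2; rewrite !jle_op in gk2 kg2.
have g2f : jle (gamma e2) f /\ jle f (gamma e2).
  by rewrite -!(@jle_op T); split; [exact: (@Req_jle (op T))|
    apply: (@Req_jle (op T)); exact: (@Req_sym (op T))].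
have j12 : jle e1 e2.
  apply: Psi_jle Ek1 Ek2 _; apply: (jle_trans kb1).
  apply: (jle_trans (Req_jle b1)); exact: jle_trans g2f.2 gk2.
have j21 : jle e2 e1.
  apply: Psi_jle Ek2 Ek1 _; apply: (jle_trans kg2).
  apply: (jle_trans g2f.1); exact: jle_trans (Req_jle (Req_sym b1)) bk1.
(* [e] is the idempotent in the R-class of [e1] and the L-class of [e2], so [theta e] is R-related
   and L-related to [f], hence equal to it. *)
pose e := loc (e1 * e2); have ee : idem e by exact: loc_idem.
have be : beta e = beta e1.
  apply/esym/bR => //; apply: Req_trans (Req_mul j12) _; exact: Req_loc.
have ge : gamma e = gamma e2.
  apply/esym/gR => //; apply: (@Req_trans (op S) (e1 * e2)).
    by apply: (@Req_mul (op S) e2 e1); rewrite jle_op.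
  by have := @Req_loc (op S) (e1 * e2); rewrite loc_op.
have loce : loc e = e by exact: loc_id.
pose b := beta e; pose r := gamma e; pose E := Psi p e.
have bkk k : E k -> twin (b * k) k by move=> Ek; exact: bT.
have krk k : E k -> @twin (op T) (k * r) k by move=> Ek; exact: gT.
have theta_e k : E k -> theta e = b * k * r.
  by move=> Ek; rewrite /theta (thetaE beta gamma (Ek : Psi p e k)) loce.
have ef : theta e = f.
  apply: Req_op_eq => //.
  - by rewrite /idem /theta -(thetaM mb mg) ee.
  - have := theta_Req mb mg e; rewrite loce be => h.
    exact: Req_trans (Req_sym h) b1.
  - have := theta_Req_op e; rewrite loce ge => h.
    exact: (@Req_trans (op T) _ _ _ (@Req_sym (op T) _ _ h) g2).
have bkr k : E k -> b * k * r = f by move=> Ek; rewrite -ef (theta_e _ Ek).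
have Ekk k : E k -> k * k = k by move=> Ek; exact: (Psi_idem ee Ek).
have EE : E ** E = E by rewrite /E -PsiM ee.
have Emul k l : E k -> E l -> E (k * l) by move=> Ek El; rewrite -EE; exact: setmul_in.
have sand u v k : E k -> u * f = u -> f * v = v -> u * k * v = u * v.
  move=> Ek uf fv; rewrite -(twin_mull u (bkk _ Ek)) -[LHS]mulA.
  have -> : b * k * v = v.
    by rewrite -mulA -(twin_op_mulr v (krk _ Ek)) !mulA bkr.
  by [].
have kfl k l : E k -> k * f * l = k * l.
  move=> Ek; rewrite -(bkr _ Ek) !mulA -(mulA k b) (twin_mull k (bkk _ Ek)) (Ekk _ Ek).
  by rewrite (twin_op_mulr l (krk _ Ek)).
(* These sets are mutually inverse with identity [E]. Their preimages are then mutually inverse with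
   identity [{e}], which forces the preimage of [A'] to be a singleton [{a}]. *)
pose A' := E ** [set c] ** E; pose B' := E ** [set inv c] ** E.
have prodE u v : u * v = f -> u * f = u -> f * v = v ->
    (E ** [set u] ** E) ** (E ** [set v] ** E) = E.
  move=> uv uf fv; apply/seteqP; split.
    move=> _ [_ [_ [[_ [l [/setmul1r[k Ek ->] El ->]]]
      [_ [n [/setmul1r[m Em ->] En ->]]] ->]]].
    suff -> : k * u * l * (m * v * n) = k * n by exact: Emul.
    have -> : k * u * l * (m * v * n) = k * (u * (l * m) * v) * n by rewrite !mulA.
    by rewrite (sand _ _ _ (Emul _ _ El Em) uf fv) uv kfl.
  move=> k Ek; suff <- : k * u * k * (k * v * k) = k by do !apply: setmul_in.
  have -> : k * u * k * (k * v * k) = k * (u * (k * k) * v) * k by rewrite !mulA.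
  by rewrite (sand _ _ _ (Emul _ _ Ek Ek) uf fv) uv kfl // Ekk.
have EA : E ** A' = A' by rewrite /A' !setmulA EE.
have AE : A' ** E = A' by rewrite /A' -setmulA EE.
have AB : A' ** B' = E by exact: prodE.
have BA : B' ** A' = E.
  by apply: prodE => //; exact: inv_loc.
pose A := bwd p A'; pose B := bwd p B'.
have bE : bwd p E = [set e] by exact: fwdK.
have eA : [set e] ** A = A by rewrite -bE /A -bwdM EA.
have Ae : A ** [set e] = A by rewrite -bE /A -bwdM AE.
have AB1 : A ** B = [set e] by rewrite -bE /A /B -bwdM AB.
have BA1 : B ** A = [set e] by rewrite -bE /A /B -bwdM BA.
have [k Ek] := Psi_n0 p e; have A'k : A' (k * c * k) by do !apply: setmul_in.
have [a Aa] : A !=set0 by apply: (fwd_n0 (power_iso_sym p)); exists (k * c * k).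
have [d Bd] : B !=set0.
  by apply: (fwd_n0 (power_iso_sym p)); exists (k * inv c * k); do !apply: setmul_in.
have ABe x y : A x -> B y -> x * y = e.
  by move=> Ax By; have : (A ** B) (x * y) by [exact: setmul_in]; rewrite AB1.
have BAe x y : A x -> B y -> y * x = e.
  by move=> Ax By; have : (B ** A) (y * x) by [exact: setmul_in]; rewrite BA1.
have Ax_e x : A x -> e * x = x.
  by rewrite -{1}eA => /setmul1l[y _ ->]; rewrite mulA ee.
have Ax_e' x : A x -> x * e = x.
  by rewrite -{1}Ae => /setmul1r[y _ ->]; rewrite -mulA ee.
have A1 : A = [set a].
  apply/seteqP; split=> [x Ax|x -> //].
  by rewrite /= -(Ax_e' x Ax) -(BAe a d Aa Bd) mulA (ABe x d Ax Bd) Ax_e.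
have PsiA : Psi p a = A' by rewrite /Psi -A1 bwdK.
have loca : loc a = e.
  rewrite -(mul_locr (Ax_e' a Aa)) -(ABe a d Aa Bd).
  by rewrite mulA locl.
exists a; have ax : Psi p a (k * c * k) by rewrite PsiA.
rewrite /theta (thetaE beta gamma ax) loca -/b -/r.
have h1 : b * k * c = c by rewrite -mulA -(twin_op_mulr c (krk _ Ek)) !mulA bkr.
by rewrite !mulA h1 -(twin_mull c (bkk _ Ek)) -mulA bkr.
Qed.

End ThetaBijective.

Lemma power_isomorphic (S T : crsemigroup) : GCH -> power_iso S T ->
  exists h : S -> T, {morph h : x y / x * y} /\ bijective h.
Proof.
move=> gch p; have [beta mb] := exists_rclass_match p gch.
have [gamma mg] := exists_rclass_match (power_iso_op p) gch.
exists (theta p beta gamma); split; first exact: thetaM.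
have /choice[g gK] := theta_surj mb mg.
by exists g => // x; apply: (theta_inj mb mg); rewrite gK.
Qed.

(** * Transfer to the packed semigroups *)

Section FromSemigroup.
Variables (S : semigroupType) (crS : completely_regular S).

(** Replacing [x] by [x * a * x] keeps the first two equations and adds the third. *)
Lemma cr_inv (a : S) : exists x, [/\ a = (a * x * a)%g, (a * x = x * a)%g &
  (x * a * x)%g = x].
Proof.
have [x [axa ax]] := crS a.
have xaxa : (x * a * x * a)%g = (x * a)%g by rewrite -2!mulgA (mulgA a) -axa.
exists (x * a * x)%g; split; first by rewrite !mulgA -axa.
  by rewrite xaxa !mulgA -axa.
by rewrite xaxa !mulgA xaxa.
Qed.

Definition cr_choose (a : S) : S := sval (cid (cr_inv a)).

Definition crsemigroup_of : crsemigroup.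
Proof.
apply: (@CRSemigroup S (fun x y => (x * y)%g) cr_choose) => [x y z|a|a|a].
- by rewrite mulgA.
- by rewrite /cr_choose; case: cid => x [].
- by rewrite /cr_choose; case: cid => x [].
- by rewrite /cr_choose; case: cid => x [].
Defined.

End FromSemigroup.

Section ExtendIso.
Variables (S S' : semigroupType).

Definition extend (f : power S -> power S') (A : set S) : set S' :=
  if pselect (A !=set0) is left h then sval (f (exist _ A h)) else set0.

Lemma extendE f A (h : A !=set0) : extend f A = sval (f (exist _ A h)).
Proof.
rewrite /extend; case: pselect => // h'.
by congr (sval (f (exist _ _ _))); exact: Prop_irrelevance.
Qed.

Lemma extend0 f : extend f set0 = set0.
Proof. by rewrite /extend; case: pselect => // -[]. Qed.

End ExtendIso.

Lemma extendK (S S' : semigroupType) (f : power S -> power S') g :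
  cancel f g -> cancel (extend f) (extend g).
Proof.
move=> fK A; have [h|/set0P/negP] := pselect (A !=set0); last first.
  by rewrite negbK => /eqP->; rewrite !extend0.
rewrite (extendE f h) (extendE g (svalP (f (exist _ A h)))).
have svalK (Z : power S') : exist _ (sval Z) (svalP Z) = Z.
  by apply: eq_sig_hprop => // ? ? ?; exact: Prop_irrelevance.
by rewrite svalK fK.
Qed.

Lemma extendM (S S' : semigroupType) (crS : completely_regular S)
    (crS' : completely_regular S') (f : {multiplicative power S -> power S'})
    (A B : set (crsemigroup_of crS)) :
  extend f (A ** B) = @setmul (crsemigroup_of crS') (extend f A) (extend f B).
Proof.
have [hA|/set0P/negP] := pselect (A !=set0); last first.
  rewrite negbK => /eqP->; rewrite (_ : set0 ** B = set0) ?extend0.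
    by apply/seteqP; split=> x // [? [? []]].
  by apply/seteqP; split=> x // [? [? []]].
have [hB|/set0P/negP] := pselect (B !=set0); last first.
  rewrite negbK => /eqP->; rewrite (_ : A ** set0 = set0) ?extend0.
    by apply/seteqP; split=> x // [? [? []]].
  by apply/seteqP; split=> x // [? [? []]].
rewrite (extendE f hA) (extendE f hB) (extendE f (setmuln0 hA hB)).
pose XA : power S := exist _ A hA; pose XB : power S := exist _ B hB.
have -> : exist _ (A ** B) (setmuln0 hA hB) = (XA * XB : power S)%g.
  apply: eq_sig_hprop => [? ? ?|/=]; first exact: Prop_irrelevance.
  apply/seteqP; split=> x; first by move=> [a [b [Aa Bb ->]]]; exists a => //; exists b.
  by move=> [a Aa [b Bb <-]]; exact: (@setmul_in (crsemigroup_of crS)).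
rewrite gmulfM; apply/seteqP; split=> x.
  by move=> [a Aa [b Bb <-]]; exact: (@setmul_in (crsemigroup_of crS')).
by move=> [a [b [Aa Bb ->]]]; exists a => //; exists b.
Qed.

Theorem theorem5p4 : GCH -> globally_determined completely_regular.
Proof.
move=> gch S S' crS crS' [f [g fK gK]].
pose p : power_iso (crsemigroup_of crS) (crsemigroup_of crS') :=
  @PowerIso (crsemigroup_of crS) (crsemigroup_of crS') _ _ (extendK fK) (extendK gK) (@extendM S S' crS crS' f).
have [h [hM h_bij]] := power_isomorphic gch p.
pose hm := isMultiplicative.Build S S' h hM.
pose hh : {multiplicative S -> S'} := HB.pack h hm.
by exists hh.
Qed.
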